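(* Let $\beta^\pm_t=\gamma^\pm$ for all $t\in[0,T]$, let $w^*=\frac{\gamma^+}{\gamma^++\gamma^-}$ and $p^*=\int_{[0,1]^2}w^*$. Fix $\delta\in(0,1-p^* )$, $\epsilon\in(0,T)$ and a nonempty closed $\mathcal T\subseteq[0,T]$. Let $$\widehat{\mathcal H}^\epsilon_{\delta,\mathcal T}:=\operatorname{argmin}\Big\{\widehat I^{(\beta^+,\beta^-)}_\epsilon(\widehat\phi):\ \widehat\phi\in\mathbb C([0,T]:(\widehat{\mathcal S}_0,\delta_\square)),\ \sup_{t\in\mathcal T}\mathfrak t(\widehat{\phi_t})\ge p^*+\delta\Big\}.$$ Then $$\widehat{\mathcal H}^\epsilon_{\delta,\mathcal T}=\Big\{\widehat{\mathrm{Av}^\epsilon(\phi)}:\ \phi=\phi^{*,t,\delta}\text{ for some }t\in\mathcal T^*\Big\},\qquad\mathcal T^*:=\operatorname{argmin}\{|U_\epsilon(t)|:t\in\mathcal T\}.$$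
   Context: $T\in(0,\infty)$, $[0,1]^2_T=[0,1]^2\times[0,T]$. $\gamma^+,\gamma^-:[0,1]^2\to[0,\infty)$ are measurable functions in $L^1([0,1]^2)$ with $\gamma^\pm\ge c_\beta$ a.e. for some constant $c_\beta>0$. $\mathcal S_0$: measurable $f:[0,1]^2\to\mathbb R$ with $0\le f\le1$ a.e.; $\mathcal W_0$: measurable $\phi:[0,1]^2\times[0,T]\to\mathbb R$ with $0\le\phi\le1$ a.e. (identified if equal a.e.); $\phi_s=\phi(\cdot,\cdot,s)$. $\mathbb C([0,T]:S)$ is the space of continuous paths in a metric space $S$ with uniform convergence; in $\mathbb C([0,T]:\mathcal S_0)$, $\mathcal S_0$ carries the (compact metrizable) weak topology inherited from $L^2([0,1]^2)$. $U_\epsilon(t)=[t-\epsilon,t+\epsilon]\cap[0,T]$, with length $|U_\epsilon(t)|$, and for $\phi\in\mathcal W_0$, $\mathrm{Av}^\epsilon(\phi)_t=\frac1{|U_\epsilon(t)|}\int_{U_\epsilon(t)}\phi_s\,ds$. Optimizers. For $t\in[0,T]$, $\phi^{*,t,\delta}\in\mathcal W_0$ is defined by $\phi^{*,t,\delta}_s=f^*_\delta$ for $s\in U_\epsilon(t)$ and $\phi^{*,t,\delta}_s=w^*$ for $s\notin U_\epsilon(t)$, where $f^*_\delta=\frac12+\frac{\gamma^+-\gamma^-+\lambda_\delta}{2\sqrt{(\gamma^+-\gamma^-+\lambda_\delta)^2+4\gamma^+\gamma^-}}$ and $\lambda_\delta\in\mathbb R$ is the unique real number with $\int_{[0,1]^2}f^*_\delta=p^*+\delta$.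 Cut metric. $d_\square(f,g)=\sup_{A,B\subseteq[0,1]\text{ measurable}}|\int_{A\times B}(f-g)|$ on $\mathcal S_0$. Let $\mathscr S$ be the group of measure-preserving bijections of $[0,1]$ and $f^\sigma(x,y)=f(\sigma(x),\sigma(y))$. Write $f\sim g$ iff $\inf_{\sigma\in\mathscr S}d_\square(f,g^\sigma)=0$; $\widehat f$ is the class of $f$, $\widehat{\mathcal S}_0$ the set of classes, with metric $\delta_\square(\widehat f,\widehat g)=\inf_{f'\in\widehat f,g'\in\widehat g}d_\square(f',g')$. For a path $\phi=(\phi_t)$ in $\mathcal S_0$, $\widehat\phi=(\widehat{\phi_t})_{t\in[0,T]}$. The edge density $\mathfrak t(\widehat f)=\int_{[0,1]^2}f$ is well defined on classes. Rate functions. $J^{(\beta^+,\beta^-)}(\phi)=\int_{[0,1]^2_T}\big(\sqrt{\beta^+(1-\phi)}-\sqrt{\beta^-\phi}\big)^2$ for $\phi\in\mathcal W_0$; $I^{(\beta^+,\beta^-)}_\epsilon(\phi^* )=\inf\{J^{(\beta^+,\beta^-)}(\tilde\phi):\tilde\phi\in\mathcal W_0,\ \mathrm{Av}^\epsilon(\tilde\phi)=\phi^*\}$ for $\phi^*\in\mathbb C([0,T]:\mathcal S_0)$ ($\inf\emptyset=\infty$); $\widehat I^{(\beta^+,\beta^-)}_\epsilon(\widehat\phi)=\sup_{\eta>0}\inf\{I^{(\beta^+,\beta^-)}_\epsilon(\phi^* ):\phi^*\in\mathbb C([0,T]:\mathcal S_0),\ \sup_{t\in[0,T]}\delta_\square(\widehat{\phi_t},\widehat{\phi^*_t})<\eta\}$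 for $\widehat\phi\in\mathbb C([0,T]:(\widehat{\mathcal S}_0,\delta_\square))$. *)

(* Defs.v *)
From HB Require Import structures.
From mathcomp Require Import all_boot all_order all_algebra.
From mathcomp Require Import all_classical all_reals all_analysis.

Set Implicit Arguments.
Unset Strict Implicit.
Unset Printing Implicit Defensive.

Import Order.TTheory GRing.Theory Num.Theory.
Import numFieldNormedType.Exports.

Local Open Scope classical_set_scope.
Local Open Scope ring_scope.

Definition argmin {d : Order.disp_t} {Y : porderType d} {X : Type}
    (F : X -> Y) (A : set X) : set X :=
  [set x | A x /\ forall y, A y -> (F x <= F y)%O].

(* mR R is R with its Borel sets, in the display used by lebesgue_measure *)
Notation mR R := (measurableTypeR R).
Notation leb1 R := (@lebesgue_measure R).
Notation leb2 R := (product_measure1 (leb1 R) (leb1 R)).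
Notation leb3 R := (product_measure1 (leb2 R) (leb1 R)).

Section Defs.
Context {R : realType}.

Definition sqr01 : set (mR R * mR R) := `[0, 1] `*` `[0, 1].

(* Elements of a function space on the square (or on square x [0, T]) are
   represented by total functions; only their values there are ever used. *)
Definition S0 : set (R * R -> R) :=
  [set f : R * R -> R | measurable_fun sqr01 (f : mR R * mR R -> R) /\
  {ae leb2 R, forall z, sqr01 z -> 0 <= f z <= 1}].

Definition eq_ae (f g : R * R -> R) :=
  {ae leb2 R, forall z, sqr01 z -> f z = g z}.

Definition L2 : set (R * R -> R) :=
  [set g : R * R -> R | measurable_fun sqr01 (g : mR R * mR R -> R) /\
  (leb2 R).-integrable sqr01 (fun z => (g z ^+ 2)%:E)].

Definition sqr01T (T : R) : set (mR R * mR R * mR R) := sqr01 `*` `[0, T].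

Definition W0 (T : R) : set (R * R * R -> R) :=
  [set phi : R * R * R -> R | measurable_fun (sqr01T T) (phi : mR R * mR R * mR R -> R) /\
    {ae leb3 R, forall z, sqr01T T z -> 0 <= phi z <= 1}].

(* the topology is the subspace one, inherited from R *)
Definition time (T : R) := set_type (`[0, T] : set R).
HB.instance Definition _ (T : R) := Topological.on (time T).

(* Continuity into S0 with the weak topology inherited from L2, i.e. the
   coarsest one making all f |-> int f g, g in L2, continuous. *)
Definition pathS0 (T : R) : set (time T -> R * R -> R) :=
  [set phi | (forall t, S0 (phi t)) /\
    forall g, L2 g ->
      continuous (fun t => \int[leb2 R]_(z in sqr01) (phi t z * g z))].

Definition U (T eps : R) (t : time T) : set R :=
  `[\val t - eps, \val t + eps] `&` `[0, T].

Definition lenU (T eps : R) (t : time T) : R := fine (leb1 R (U eps t)).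

Definition Av (T eps : R) (phi : R * R * R -> R) (t : time T) (z : R * R) : R :=
  (lenU eps t)^-1 * \int[leb1 R]_(s in U eps t) phi (z, s).

Definition dcut (f g : R * R -> R) : R :=
  sup [set r | exists A B : set (mR R), [/\ measurable A, measurable B,
    A `<=` `[0, 1], B `<=` `[0, 1] &
    r = `| \int[leb2 R]_(z in A `*` B) (f z - g z) |]].

(* Borel automorphisms; every Lebesgue one agrees a.e. with a Borel one *)
Definition mp_bijection (sigma : R -> R) : Prop :=
  [/\ set_bij `[0, 1] `[0, 1] sigma, measurable_fun (`[0, 1] : set (mR R)) (sigma : mR R -> mR R) &
    forall A : set (mR R), measurable A -> A `<=` `[0, 1] ->
      measurable (sigma @` A : set (mR R)) /\ leb1 R (`[0, 1] `&` sigma @^-1` A) = leb1 R A].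

Definition permute (f : R * R -> R) (sigma : R -> R) : R * R -> R :=
  fun z => f (sigma z.1, sigma z.2).

Definition cut_equiv (f g : R * R -> R) : Prop :=
  inf [set dcut f (permute g sigma) | sigma in mp_bijection] = 0.

(* Classes are represented as sets of members of S0; since dcut vanishes on
   a.e. equal functions, they are saturated for a.e. equality. *)
Definition hat (f : R * R -> R) : set (R * R -> R) :=
  [set g | S0 g /\ cut_equiv f g].

Definition hatS0 : set (set (R * R -> R)) := [set hat f | f in S0].

Definition deltacut (C D : set (R * R -> R)) : R :=
  inf [set dcut f g | f in C & g in D].

Definition hat_path (T : R) (phi : time T -> R * R -> R) :
  time T -> set (R * R -> R) := fun t => hat (phi t).

Definition path_hatS0 (T : R) : set (time T -> set (R * R -> R)) :=
  [set p : time T -> set (R * R -> R) | (forall t, hatS0 (p t)) /\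
    forall t, deltacut (p t) (p s) @[s --> t] --> (0 : R)].

(* computed on a chosen member of C: all of them have the same integral *)
Definition edge_density (C : set (R * R -> R)) : R :=
  \int[leb2 R]_(z in sqr01) (get C) z.

Definition rate_J (T : R) (betap betam phi : R * R * R -> R) : \bar R :=
  (\int[leb3 R]_(z in sqr01T T)
    ((Num.sqrt (betap z * (1 - phi z)) - Num.sqrt (betam z * phi z)) ^+ 2)%:E)%E.

(* elements of W0 are only determined up to null sets, hence eq_ae at each t *)
Definition rate_I (T : R) (betap betam : R * R * R -> R) (eps : R)
    (phi : time T -> R * R -> R) : \bar R :=
  ereal_inf [set rate_J T betap betam psi | psi in
    [set psi | W0 T psi /\ forall t, eq_ae (Av eps psi t) (phi t)]].

Definition rate_hatI (T : R) (betap betam : R * R * R -> R) (eps : R)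
    (p : time T -> set (R * R -> R)) : \bar R :=
  ereal_sup [set ereal_inf [set rate_I betap betam eps phi | phi in
      [set phi | pathS0 phi /\
        sup (range (fun t => deltacut (p t) (hat_path phi t))) < eta]]
    | eta in [set eta : R | 0 < eta]].

Definition wstar (gammap gammam : R * R -> R) (z : R * R) : R :=
  gammap z / (gammap z + gammam z).

Definition pstar (gammap gammam : R * R -> R) : R :=
  \int[leb2 R]_(z in sqr01) wstar gammap gammam z.

Definition f_lambda (gammap gammam : R * R -> R) (lambda : R) (z : R * R) : R :=
  2^-1 + (gammap z - gammam z + lambda) /
    (2 * Num.sqrt ((gammap z - gammam z + lambda) ^+ 2
                   + 4 * gammap z * gammam z)).

(* such a lambda exists and is unique for 0 < delta < 1 - pstar *)
Definition lambda_delta (gammap gammam : R * R -> R) (delta : R) : R :=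
  get [set lambda | \int[leb2 R]_(z in sqr01) f_lambda gammap gammam lambda z
                    = pstar gammap gammam + delta].

Definition fstar (gammap gammam : R * R -> R) (delta : R) : R * R -> R :=
  f_lambda gammap gammam (lambda_delta gammap gammam delta).

Definition phistar (T : R) (gammap gammam : R * R -> R) (eps : R) (t : time T)
    (delta : R) : R * R * R -> R :=
  fun z => if z.2 \in U eps t then fstar gammap gammam delta z.1
           else wstar gammap gammam z.1.

Definition hatH (T : R) (gammap gammam : R * R -> R) (eps delta : R)
    (TT : set (time T)) : set (time T -> set (R * R -> R)) :=
  argmin (rate_hatI (fun z => gammap z.1) (fun z => gammam z.1) eps)
    [set p : time T -> set (R * R -> R) | path_hatS0 p /\
      pstar gammap gammam + delta <= sup [set edge_density (p t) | t in TT]].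

End Defs.

(* Main.v *)
From HB Require Import structures.
Require Import Defs.
From mathcomp Require Import all_boot all_order all_algebra.
From mathcomp Require Import all_classical all_reals all_analysis.
From mathcomp Require Import measurable_realfun ring lra.

(** For [p, m >= c > 0] the integrand [L x = (sqrt (p (1 - x)) - sqrt (m x))^2]
    of the rate function is strongly convex on [[0, 1]], and the value of
    [f_lambda] is the point [f] where [L] has slope [lambda]; hence
    [L x >= L f + lambda (x - f) + 2 c (x - f)^2]. Let [K] be the integral of
    [L] along [fstar]. If the average of [psi] over [U eps t] has edge density
    at least [pstar + delta - eta], integrating this inequality with slope
    [lambda_delta >= 0] on [U eps t] and slope [0] elsewhere gives
    [J psi >= lenU t * (K - lambda_delta * eta) + 2 c |psi - phistar t|_2^2].
    Letting [eta] tend to [0], the infimum under the constraint at time [t] is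
    [lenU t * K], with [K > 0], and almost optimal [psi] are close in L2 to
    [phistar t]. Their averages are then close in L1, a fortiori in the cut
    metric, to those of [phistar t], so a minimizing path of classes is at
    distance [0] from that of [phistar t]. No compactness of the space of
    graphons is involved: a constraint time [t] where the edge density is
    attained exists because the set of times is compact. *)

Set Implicit Arguments.
Unset Strict Implicit.
Unset Printing Implicit Defensive.

Import Order.TTheory GRing.Theory Num.Theory.
Import numFieldNormedType.Exports.
Local Open Scope classical_set_scope.
Local Open Scope ring_scope.

(** * Integration on product spaces *)

Section measure_tools.
Context d (T : measurableType d) (R : realType).
Variables (mu : {measure set T -> \bar R}) (D : set T).
Hypothesis mD : measurable D.

Lemma ae_eq_integrable (f g : T -> \bar R) : measurable_fun D g ->
  ae_eq mu D f g -> mu.-integrable D f -> mu.-integrable D g.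
Proof.
move=> mg fg /integrableP[mf foo]; apply/integrableP; split => //.
rewrite (ae_eq_integral (fun x => `|f x|%E))//.
- exact: measurableT_comp.
- exact: measurableT_comp.
- exact/ae_eq_abse/ae_eq_sym.
Qed.

Lemma ae_le_integrable (f g : T -> R) : measurable_fun D f ->
  mu.-integrable D (EFin \o g) -> {ae mu, forall x, D x -> `|f x| <= g x} ->
  mu.-integrable D (EFin \o f).
Proof.
move=> mf /integrableP[mg goo] fg; apply/integrableP; split.
  exact/measurable_EFinP.
apply: le_lt_trans goo; apply: ae_ge0_le_integral => //.
- by apply: measurableT_comp => //; exact/measurable_EFinP.
- exact: measurableT_comp.
- apply: filterS fg => x /= + Dx => /(_ Dx) fg.
  by rewrite lee_fin; exact: le_trans fg (ler_norm _).
Qed.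

Lemma ae_bounded_integrable (M : R) (f : T -> R) : (mu D < +oo)%E ->
  measurable_fun D f -> {ae mu, forall x, D x -> `|f x| <= M} ->
  mu.-integrable D (EFin \o f).
Proof.
move=> Doo mf; apply: (@ae_le_integrable _ (cst M)) => //.
apply/integrableP; split; first exact/measurable_EFinP.
rewrite (eq_integral (cst `|M|%:E))//.
by rewrite integral_cst// lte_mul_pinfty// lee_fin.
Qed.

(** Monotonicity of the integral asks for an inequality at every point. The function [min f g]
    satisfies it against [g] everywhere on [D] and equals [f] almost everywhere. *)
Lemma ae_le_Rintegral (f g : T -> R) :
  mu.-integrable D (EFin \o f) -> mu.-integrable D (EFin \o g) ->
  {ae mu, forall x, D x -> f x <= g x} ->
  \int[mu]_(x in D) f x <= \int[mu]_(x in D) g x.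
Proof.
move=> fi gi fg.
have mf : measurable_fun D f by apply/measurable_EFinP; exact: measurable_int fi.
have mg : measurable_fun D g by apply/measurable_EFinP; exact: measurable_int gi.
have mfg : measurable_fun D (fun x => Num.min (f x) (g x)).
  exact: measurable_minr.
have efg : ae_eq mu D (EFin \o f) (EFin \o (fun x => Num.min (f x) (g x))).
  by apply: filterS fg => x /= h Dx; congr EFin; apply/esym/min_idPl/h.
have fgi : mu.-integrable D (EFin \o (fun x => Num.min (f x) (g x))).
  by apply: ae_eq_integrable efg fi; exact/measurable_EFinP.
rewrite [leLHS](_ : _ = \int[mu]_(x in D) (Num.min (f x) (g x))).
  by apply: le_Rintegral => // x Dx; rewrite ge_min lexx orbT.
by congr fine; apply: ae_eq_integral => //; exact/measurable_EFinP.
Qed.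

Lemma ae_eq_Rintegral (f g : T -> R) :
  measurable_fun D f -> measurable_fun D g ->
  {ae mu, forall x, D x -> f x = g x} ->
  \int[mu]_(x in D) f x = \int[mu]_(x in D) g x.
Proof.
move=> mf mg fg; congr fine; apply: ae_eq_integral => //.
- exact/measurable_EFinP.
- exact/measurable_EFinP.
- by apply: filterS fg => x /= h /h ->.
Qed.

Lemma subset_le_Rintegral (E : set T) (f : T -> R) : measurable E -> E `<=` D ->
  mu.-integrable D (EFin \o f) -> (forall x, D x -> 0 <= f x) ->
  \int[mu]_(x in E) f x <= \int[mu]_(x in D) f x.
Proof.
move=> mE ED fi f0.
have fiE : mu.-integrable E (EFin \o f) by exact: integrableS fi.
apply: fine_le; [exact: integrable_fin_num|exact: integrable_fin_num|].
apply: ge0_subset_integral => //; first exact: measurable_int fi.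
Qed.

End measure_tools.

(** * Fubini and Tonelli on boxes *)

Section product_tools.
Context d1 d2 (T1 : measurableType d1) (T2 : measurableType d2) (R : realType).
Context {m1 : {sigma_finite_measure set T1 -> \bar R}}
        {m2 : {sigma_finite_measure set T2 -> \bar R}}.
Variables (A : set T1) (B : set T2).
Hypotheses (mA : measurable A) (mB : measurable B).

(** The product measure of [N] is the integral of the measures of its sections, and a nonnegative
    function with zero integral vanishes almost everywhere. *)
Lemma ae_xsection0 (N : set (T1 * T2)) : measurable N ->
  product_measure1 m1 m2 N = 0%E -> {ae m1, forall x, m2 (xsection N x) = 0%E}.
Proof.
move=> mN N0.
have mx := measurable_fun_xsection m2 mN.
have /(ae_eq_integral_abs m1 measurableT mx) :
    (\int[m1]_x `|(m2 \o xsection N) x| = 0)%E.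
  by rewrite -N0; apply: eq_integral => x _; rewrite gee0_abs.
by apply: filterS => x /(_ I).
Qed.

Lemma ae_prod_section (P : T1 -> T2 -> Prop) :
  {ae product_measure1 m1 m2, forall z, P z.1 z.2} ->
  {ae m1, forall x, {ae m2, forall y, P x y}}.
Proof.
move=> [N [mN N0 PN]]; apply: filterS (ae_xsection0 mN N0) => x Nx0.
exists (xsection N x); split => //; first exact: measurable_xsection.
by move=> y /= nP; rewrite /xsection/= inE; apply: PN.
Qed.

Lemma ae_prod_fst (P : T1 -> Prop) :
  {ae m1, forall x, P x} -> {ae product_measure1 m1 m2, forall z, P z.1}.
Proof.
move=> [N [mN N0 PN]]; exists (N `*` setT); split.
- exact: measurableX.
- transitivity (m1 N * m2 setT)%E; first exact: product_measure1E.
  by rewrite N0 mul0e.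
- by move=> z /= nP; split => //; exact: PN.
Qed.

(** Tonelli for the extension of [f] by zero off [A] times the indicator of [B]. The measure of [B]
    may be infinite here. *)
Lemma ge0_integral_fst (f : T1 -> R) : measurable_fun A f ->
  (forall x, A x -> 0 <= f x) ->
  (\int[product_measure1 m1 m2]_(z in A `*` B) (f z.1)%:E =
   (\int[m1]_(x in A) (f x)%:E) * m2 B)%E.
Proof.
move=> mf f0.
pose F x := ((f \_ A) x)%:E.
have mF : measurable_fun setT F.
  by apply/measurable_EFinP; apply/(measurable_restrictT _ mA).
have F0 x : (0 <= F x)%E.
  by rewrite lee_fin /patch; case: ifPn => // /[!inE]; exact: f0.
have mAB : measurable (A `*` B) by exact: measurableX.
have m1B : measurable_fun [set: T2] (EFin \o \1_B : T2 -> \bar R).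
  exact/measurable_EFinP/measurable_indic.
transitivity (\int[product_measure1 m1 m2]_z (F z.1 * (\1_B z.2)%:E))%E.
  rewrite integral_mkcond; apply: eq_integral => -[x y] _ /=.
  rewrite /F /patch /indic in_setX/=; case: (x \in A) => /=; last by rewrite mul0e.
  by case: (y \in B); rewrite ?mule1 ?mule0.
rewrite fubini_tonelli1; last 2 first.
- apply: emeasurable_funM.
    exact: (measurableT_comp mF measurable_fst).
  exact: (measurableT_comp m1B measurable_snd).
- by move=> z; rewrite mule_ge0// lee_fin.
rewrite [X in (X * _)%E]integral_mkcond.
have -> : (fun x => (f x)%:E) \_ A = F.
  by apply/funext => x; rewrite /F /patch; case: ifP.
rewrite -ge0_integralZr//.
apply: eq_integral => x _; rewrite /fubini_F /=.
rewrite ge0_integralZl// integral_indic// setIT//.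
Qed.

Lemma integrable_fst (f : T1 -> R) : (m2 B < +oo)%E ->
  m1.-integrable A (EFin \o f) ->
  (product_measure1 m1 m2).-integrable (A `*` B) (fun z => (f z.1)%:E).
Proof.
move=> Boo /integrableP[/measurable_EFinP mf foo]; apply/integrableP; split.
  apply/measurable_EFinP.
  apply: (@measurable_comp _ _ _ _ _ _ A) => //; first by move=> _ [z [+ _] <-].
  exact: measurable_funTS.
rewrite (ge0_integral_fst (f := fun x => `|f x|)).
- apply: lte_mul_pinfty => //.
    by apply: integral_ge0 => x _; rewrite lee_fin.
  rewrite ge0_fin_numE//; apply: integral_ge0 => x _; by rewrite lee_fin.
- exact: measurableT_comp.
- by [].
Qed.

Lemma Rintegral_fst (f : T1 -> R) : (m2 B < +oo)%E ->
  m1.-integrable A (EFin \o f) -> (forall x, A x -> 0 <= f x) ->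
  \int[product_measure1 m1 m2]_(z in A `*` B) f z.1 =
  \int[m1]_(x in A) f x * fine (m2 B).
Proof.
move=> Boo fi f0; rewrite /Rintegral ge0_integral_fst//.
  by rewrite fineM//; [exact: integrable_fin_num|rewrite ge0_fin_numE].
by apply/measurable_EFinP; exact: measurable_int fi.
Qed.

Variables (h : T1 * T2 -> R) (M : R).
Hypotheses (mh : measurable_fun setT h) (hM : forall z, `|h z| <= M).
Hypotheses (Aoo : (m1 A < +oo)%E) (Boo : (m2 B < +oo)%E).

(** Fubini is applied on the whole product space to this truncation, which is integrable because [h]
    is bounded and the box has finite measure. *)
Let hAB := h \_ (A `*` B).

Let hAB_int : (product_measure1 m1 m2).-integrable setT (EFin \o hAB).
Proof.
have mAB : measurable (A `*` B) by exact: measurableX.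
rewrite /hAB -restrict_EFin; apply/(integrable_mkcond _ mAB).
apply: (@ae_bounded_integrable _ _ _ _ _ mAB M).
- apply: (@le_lt_trans _ _ (m1 A * m2 B)%E).
    rewrite le_eqVlt; apply/orP; left; apply/eqP; exact: product_measure1E.
  by rewrite lte_mul_pinfty// ge0_fin_numE.
- exact: measurable_funTS.
- exact: aeW.
Qed.

Let hABE x : (\int[m2]_y (hAB (x, y))%:E =
  (((fun x => \int[m2]_(y in B) h (x, y)) \_ A) x)%:E)%E.
Proof.
rewrite /patch; case: ifPn => xA; last first.
  by rewrite integral0_eq// => y _; rewrite /hAB /patch in_setX (negbTE xA).
rewrite /Rintegral fineK; last first.
  apply: integrable_fin_num => //; apply: (@ae_bounded_integrable _ _ _ _ _ mB M) => //.
  - by apply: measurable_funTS; exact: measurableT_comp.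
  - exact: aeW.
rewrite [RHS]integral_mkcond; apply: eq_integral => y _.
by rewrite /hAB /patch in_setX xA/=; case: ifPn.
Qed.

Lemma integrable_section : m1.-integrable A (fun x => (\int[m2]_(y in B) h (x, y))%:E).
Proof.
apply/(integrable_mkcond _ mA); rewrite restrict_EFin.
apply: eq_integrable (integrable_fubini_F hAB_int) => // x _.
by rewrite /fubini_F hABE.
Qed.

Lemma Rintegral_section :
  \int[m1]_(x in A) \int[m2]_(y in B) h (x, y) =
  \int[product_measure1 m1 m2]_(z in A `*` B) h z.
Proof.
rewrite [RHS]Rintegral_mkcond /Rintegral -(integral12_prod_meas1 hAB_int).
rewrite integral_mkcond; congr fine; apply: eq_integral => x _.
by rewrite /fubini_F hABE restrict_EFin.
Qed.

End product_tools.

(** * The cut metric *)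

Section unit_square.
Context {R : realType}.
Implicit Types (f g h : R * R -> R) (A B : set (mR R)).

Lemma measurable_sqr01 : measurable (@sqr01 R).
Proof. by apply: measurableX; exact: measurable_itv. Qed.
Hint Resolve measurable_sqr01 : core.

Lemma leb1_itvcc (a b : R) : a <= b -> leb1 R `[a, b] = (b - a)%:E.
Proof.
move=> ab; rewrite lebesgue_measure_itv/= lte_fin.
by case: ltP => [_|ba]; rewrite -?EFinD// (@le_anti _ _ a b) ?subrr// ab.
Qed.

Lemma leb2X A B : measurable A -> measurable B ->
  leb2 R (A `*` B) = (leb1 R A * leb1 R B)%E.
Proof. by move=> mA mB; exact: product_measure1E. Qed.

Lemma leb2_sqr01 : leb2 R sqr01 = 1%E.
Proof.
rewrite /sqr01 leb2X ?leb1_itvcc ?ler01//; try exact: measurable_itv.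
by rewrite subr0 mule1.
Qed.

Lemma sub_sqr01 A B : A `<=` `[0, 1] -> B `<=` `[0, 1] -> A `*` B `<=` sqr01.
Proof. by move=> A01 B01 z [/A01 ? /B01]. Qed.

Lemma S0_norm f : S0 f -> {ae leb2 R, forall z, sqr01 z -> `|f z| <= 1}.
Proof.
case=> _; apply: filterS => z /= h /h /andP[f0 f1].
by rewrite ger0_norm.
Qed.

Lemma S0_integrable f : S0 f -> (leb2 R).-integrable sqr01 (EFin \o f).
Proof.
move=> Sf; apply: (@ae_bounded_integrable _ _ _ (leb2 R) _ measurable_sqr01 1).
- by rewrite [ltLHS]leb2_sqr01 ltry.
- exact: Sf.1.
- exact: S0_norm.
Qed.

Lemma S0_integrableB f g : S0 f -> S0 g ->
  (leb2 R).-integrable sqr01 (EFin \o (fun z => f z - g z)).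
Proof.
move=> Sf Sg.
exact: (integrableB measurable_sqr01 (S0_integrable Sf) (S0_integrable Sg)).
Qed.

Lemma integrable_cst_sqr01 (k : R) : (leb2 R).-integrable sqr01 (EFin \o (cst k)).
Proof.
apply: (@ae_bounded_integrable _ _ _ (leb2 R) _ measurable_sqr01 `|k|) => //.
- by rewrite [ltLHS]leb2_sqr01 ltry.
- exact: aeW.
Qed.

Lemma Rintegral_cst_sqr01 (k : R) : \int[leb2 R]_(z in sqr01) (cst k z) = k.
Proof. by rewrite Rintegral_cst// [X in fine X]leb2_sqr01 mulr1. Qed.

Lemma S0_Rintegral01 f : S0 f -> 0 <= \int[leb2 R]_(z in sqr01) f z <= 1.
Proof.
move=> Sf; have fi := S0_integrable Sf.
rewrite -[X in X <= _ <= _](Rintegral_cst_sqr01 0).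
rewrite -[X in _ <= _ <= X](Rintegral_cst_sqr01 1).
apply/andP; split; apply: ae_le_Rintegral => //;
  try exact: integrable_cst_sqr01.
- by case: Sf => _; apply: filterS => z /= h /h /andP[].
- by case: Sf => _; apply: filterS => z /= h /h /andP[].
Qed.

Let dcut_set f g := [set r | exists A B, [/\ measurable A, measurable B,
  A `<=` `[0, 1], B `<=` `[0, 1] &
  r = `| \int[leb2 R]_(z in A `*` B) (f z - g z) |]].

Let dcut_set0 f g : dcut_set f g !=set0.
Proof.
exists `|\int[leb2 R]_(z in set0 `*` set0) (f z - g z)|; exists set0, set0.
by split => //; exact: sub0set.
Qed.

Lemma rectangle_le_L1 f g A B : S0 f -> S0 g -> measurable A -> measurable B ->
  A `<=` `[0, 1] -> B `<=` `[0, 1] ->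
  `| \int[leb2 R]_(z in A `*` B) (f z - g z) | <=
  \int[leb2 R]_(z in sqr01) `|f z - g z|.
Proof.
move=> Sf Sg mA mB A01 B01.
have fgi := S0_integrableB Sf Sg.
have mAB : measurable (A `*` B) by exact: measurableX.
apply: le_trans (le_normr_Rintegral _ _) _ => //.
  by apply: integrableS fgi => //; exact: sub_sqr01.
apply: subset_le_Rintegral => //; first exact: sub_sqr01.
exact: integrable_norm.
Qed.

Lemma dcut_le f g r : (forall A B, measurable A -> measurable B ->
    A `<=` `[0, 1] -> B `<=` `[0, 1] ->
    `| \int[leb2 R]_(z in A `*` B) (f z - g z) | <= r) ->
  dcut f g <= r.
Proof.
move=> h; apply: (@ge_sup _ (dcut_set f g)) => // _ [A [B [mA mB A01 B01 ->]]].
exact: h.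
Qed.

Lemma dcut_le_L1 f g : S0 f -> S0 g ->
  dcut f g <= \int[leb2 R]_(z in sqr01) `|f z - g z|.
Proof. by move=> Sf Sg; apply: dcut_le => A B *; exact: rectangle_le_L1. Qed.

(** A real supremum dominates its set only when the set is bounded; here the L1 distance is a
    bound. *)
Lemma dcut_ge f g A B : S0 f -> S0 g -> measurable A -> measurable B ->
    A `<=` `[0, 1] -> B `<=` `[0, 1] ->
  `| \int[leb2 R]_(z in A `*` B) (f z - g z) | <= dcut f g.
Proof.
move=> Sf Sg mA mB A01 B01.
apply: (@ub_le_sup _ (dcut_set f g)); last by exists A, B.
exists (\int[leb2 R]_(z in sqr01) `|f z - g z|) => _ [C [D [mC mD C01 D01 ->]]].
exact: rectangle_le_L1.
Qed.

Lemma dcut_ge0 f g : S0 f -> S0 g -> 0 <= dcut f g.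
Proof.
move=> Sf Sg; apply: le_trans (dcut_ge Sf Sg measurable0 measurable0 _ _) => //.
Qed.

Lemma eq_dcut f g f' g' : {in sqr01, f =1 f'} -> {in sqr01, g =1 g'} ->
  dcut f g = dcut f' g'.
Proof.
move=> ff' gg'; congr sup; apply/seteqP; split => _ [A [B [mA mB A01 B01 ->]]];
  exists A, B; split => //; congr `|_|; apply: eq_Rintegral => z;
  by rewrite inE => /(sub_sqr01 A01 B01) Qz; rewrite ff' ?inE// gg' ?inE.
Qed.

Lemma dcut_triangle f g h : S0 f -> S0 g -> S0 h ->
  dcut f h <= dcut f g + dcut g h.
Proof.
move=> Sf Sg Sh; apply: dcut_le => A B mA mB A01 B01.
have mAB : measurable (A `*` B) by exact: measurableX.
have ABQ := sub_sqr01 A01 B01.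
have intB u v : S0 u -> S0 v ->
    (leb2 R).-integrable (A `*` B) (EFin \o (fun z => u z - v z)).
  by move=> Su Sv; apply: integrableS (S0_integrableB Su Sv).
rewrite (_ : Rintegral _ _ _ = \int[leb2 R]_(z in A `*` B) (f z - g z)
                           + \int[leb2 R]_(z in A `*` B) (g z - h z)).
  apply: le_trans (ler_normD _ _) _; apply: lerD; exact: dcut_ge.
rewrite -RintegralD//; [|exact: intB|exact: intB].
by apply: eq_Rintegral => z _; rewrite subrKA.
Qed.

Lemma dcutC f g : S0 f -> S0 g -> dcut f g = dcut g f.
Proof.
suff h (u v : R * R -> R) : S0 u -> S0 v -> dcut u v <= dcut v u.
  by move=> Sf Sg; apply/eqP; rewrite eq_le !h.
move=> Su Sv; apply: dcut_le => A B mA mB A01 B01.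
have mAB : measurable (A `*` B) by exact: measurableX.
have ABQ := sub_sqr01 A01 B01.
have ui : (leb2 R).-integrable (A `*` B) (EFin \o u).
  by apply: integrableS (S0_integrable Su).
have vi : (leb2 R).-integrable (A `*` B) (EFin \o v).
  by apply: integrableS (S0_integrable Sv).
rewrite RintegralB// distrC -RintegralB//; exact: dcut_ge.
Qed.

Lemma Rintegral_dcut f g : S0 f -> S0 g ->
  `|\int[leb2 R]_(z in sqr01) f z - \int[leb2 R]_(z in sqr01) g z| <= dcut f g.
Proof.
move=> Sf Sg; rewrite -RintegralB//; try exact: S0_integrable.
by apply: dcut_ge => //; exact: measurable_itv.
Qed.

End unit_square.
#[local] Hint Resolve measurable_sqr01 : core.

(* The sigma-finite structure that canonical inference finds on a product
   measure is the one for subprobabilities, which does not apply to [leb1]. *)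
Section sigma_finite_leb2.
Context {R : realType}.

Let leb2_sigma_finite : sigma_finite setT (leb2 R).
Proof.
have /sigma_finiteP[F [TF ndF Foo]] := sigma_finiteT (leb1 R).
exists (fun n => F n `*` F n) => [|n]; last first.
  have [mF Fn] := Foo n; split; first exact: measurableX.
  by rewrite [ltLHS]leb2X// lte_mul_pinfty// ge0_fin_numE.
apply/seteqP; split => // -[x y] _.
have [n _ Fx] : (\bigcup_n F n) x by rewrite -TF.
have [m _ Fy] : (\bigcup_n F n) y by rewrite -TF.
exists (maxn n m) => //; split => /=.
  by move: x Fx; exact/subsetPset/ndF/leq_maxl.
by move: y Fy; exact/subsetPset/ndF/leq_maxr.
Qed.

Definition leb2_sf : {sigma_finite_measure set (mR R * mR R)%type -> \bar R} :=
  HB.pack_for {sigma_finite_measure set (mR R * mR R)%type -> \bar R} (leb2 R)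
   (Measure_isSigmaFinite.Build _ _ _ (leb2 R) leb2_sigma_finite).

End sigma_finite_leb2.

(** * Change of variables under measure-preserving bijections *)

Section rearrangement.
Context {R : realType}.
Implicit Types (f g h : R * R -> R) (A B : set (mR R)) (s t : R -> R).

(* Extending by the identity outside [0, 1] turns [s] into a measure-preserving
   bijection of the whole line. *)
Definition mp_ext s : mR R -> mR R := fun x => if x \in `[0, 1] then s x else x.

Lemma mp_ext_in s x : `[0, 1]%classic x -> mp_ext s x = s x.
Proof. by move=> x01; rewrite /mp_ext ifT. Qed.

Lemma preimage_mp_ext s A :
  mp_ext s @^-1` A = (`[0, 1] `&` s @^-1` A) `|` (A `\` `[0, 1]).
Proof.
apply/seteqP; split => x; rewrite /mp_ext/=.
  case: ifPn => x01 Ax; [by left|right; split => //; exact/negP].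
case=> [[-> //]|[Ax /negP]]; by move=> /negbTE ->.
Qed.

Lemma measurable_mp_ext s : mp_bijection s -> measurable_fun setT (mp_ext s).
Proof.
case=> _ ms _ _ A mA; rewrite setTI preimage_mp_ext; apply: measurableU.
  by apply: ms => //; exact: measurable_itv.
by apply: measurableD => //; exact: measurable_itv.
Qed.

Lemma leb1_preimage_mp_ext s A : mp_bijection s -> measurable A ->
  leb1 R (mp_ext s @^-1` A) = leb1 R A.
Proof.
move=> [[fs _ _] ms ps] mA; rewrite preimage_mp_ext.
have m01 : measurable (`[0, 1]%classic : set (mR R)) by exact: measurable_itv.
rewrite measureU//; last 3 first.
- exact: ms.
- exact: measurableD.
- by apply/seteqP; split => // x [[+ _] [_]].
(* [mp_bijection] controls the preimages of subsets of the unit interval only, so [A] is first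
   intersected with that interval, which [s] maps into itself. *)
have -> : `[0, 1] `&` s @^-1` A = `[0, 1] `&` s @^-1` (A `&` `[0, 1]).
  by apply/seteqP; split => x [x01 sx]; split => //; [split => //; exact: fs|case: sx].
have A01 : A `&` `[0, 1] `<=` `[0, 1] by move=> x [].
transitivity (leb1 R (A `\` `[0%R, 1%R]) + leb1 R (A `&` `[0%R, 1%R]))%E.
  rewrite addeC; congr (_ + _)%E.
  exact: (ps _ (measurableI _ _ mA m01) A01).2.
by rewrite -measureDI.
Qed.

Definition mp_ext2 s : mR R * mR R -> mR R * mR R :=
  fun z => (mp_ext s z.1, mp_ext s z.2).

Lemma measurable_mp_ext2 s : mp_bijection s -> measurable_fun setT (mp_ext2 s).
Proof.
move=> /measurable_mp_ext ms; apply/measurable_fun_pairP; split => /=.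
  exact: (measurableT_comp ms measurable_fst).
exact: (measurableT_comp ms measurable_snd).
Qed.

(** The pushforward of [leb2] under [mp_ext2 s] gives rectangles their product measure, hence is
    [leb2] by uniqueness of the product measure. *)
Lemma leb2_preimage_mp_ext2 s (X : set (mR R * mR R)) : mp_bijection s ->
  measurable X -> leb2 R (mp_ext2 s @^-1` X) = leb2 R X.
Proof.
move=> sP mX; have ms := measurable_mp_ext2 sP.
pose m' : {measure set (mR R * mR R) -> \bar R} :=
  measure_function_pushforward__canonical__measure_function_Measure (leb2 R) ms.
rewrite -[LHS]/(m' X); apply/esym; apply: product_measure_unique => // A B mA mB.
rewrite /m'/= /pushforward.
have -> : mp_ext2 s @^-1` (A `*` B) = (mp_ext s @^-1` A) `*` (mp_ext s @^-1` B) by [].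
have mpre C : measurable C -> measurable (mp_ext s @^-1` C).
  by move=> mC; rewrite -[X in measurable X]setTI; apply: measurable_mp_ext.
by rewrite leb2X ?leb1_preimage_mp_ext//; exact: mpre.
Qed.

Lemma integral_mp_ext2 s (X : set (mR R * mR R)) f : mp_bijection s ->
  measurable X -> measurable_fun setT (f : mR R * mR R -> R) ->
  (leb2 R).-integrable X (EFin \o f) ->
  \int[leb2 R]_(z in mp_ext2 s @^-1` X) f (mp_ext2 s z) = \int[leb2 R]_(z in X) f z.
Proof.
move=> sP mX mf fi.
have ms := measurable_mp_ext2 sP.
pose m' : {measure set (mR R * mR R) -> \bar R} :=
  measure_function_pushforward__canonical__measure_function_Measure (leb2 R) ms.
have E (F : mR R * mR R -> \bar R) : (\int[leb2 R]_(z in X) F z = \int[m']_(z in X) F z)%E.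
  apply: eq_measure_integral => A mA _; rewrite /m'/=.
  exact/esym/leb2_preimage_mp_ext2.
have fsi : (leb2 R).-integrable (mp_ext2 s @^-1` X) (EFin \o f \o mp_ext2 s).
  apply/integrableP; split.
    apply/measurable_EFinP; apply: measurable_funTS; exact: measurableT_comp.
  have /integrableP[_] := fi; rewrite E ge0_integral_pushforward//.
  by apply/measurable_EFinP; apply: measurable_funTS; exact: measurableT_comp.
congr fine; rewrite [RHS]E.
have mEf : measurable_fun setT (EFin \o f : mR R * mR R -> \bar R).
  exact/measurable_EFinP.
exact/esym/(integral_pushforward ms mEf fsi mX).
Qed.

End rearrangement.

(** * The cut distance up to rearrangement and the space of classes *)

Section cut_metric.
Context {R : realType}.
Implicit Types (f g h : R * R -> R) (A B : set (mR R)) (s t : R -> R).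

Let m01 : measurable (`[0, 1]%classic : set (mR R)).
Proof. exact: measurable_itv. Qed.

Lemma mp_bijection_id : mp_bijection (@idfun R).
Proof.
split; first by split => // x x01; exists x.
- exact: measurable_id.
- move=> A mA A01; split; first by rewrite image_id.
  by congr (leb1 R _); apply/seteqP; split => [x []//|x Ax]; split => //; exact: A01.
Qed.

Lemma mp_bijection_comp s t : mp_bijection s -> mp_bijection t ->
  mp_bijection (t \o s).
Proof.
move=> [bs ms ps] [bt mt pt]; split.
- exact: set_bij_comp bs bt.
- apply: measurable_comp mt ms => //.
  by move=> _ [x x01 <-]; case: bs => + _ _; apply.
- move=> A mA A01.
  have sA01 : s @` A `<=` `[0, 1].
    by move=> _ [x /A01 x01 <-]; case: bs => + _ _; apply.
  split; first by rewrite -image_comp; exact: (pt _ (ps _ mA A01).1 sA01).1.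
  have mtA : measurable (`[0, 1] `&` t @^-1` A : set (mR R)) by exact: mt.
  rewrite -(pt _ mA A01).2 -(ps _ mtA _).2; last by move=> x [].
  congr (leb1 R _); apply/seteqP; split => [x [x01 Ax]|x [x01 []]//].
  by split => //; split => //; case: bs => + _ _; apply.
Qed.

(** The inverse [t] is arbitrary off the unit interval. Inside it, preimages under [t] are images
    under [s] and conversely, so the two measurability clauses of [mp_bijection] exchange their
    roles. *)
Lemma mp_bijection_inv s : mp_bijection s ->
  exists2 t, mp_bijection t &
    {in `[0, 1]%classic, cancel t s} /\ {in `[0, 1]%classic, cancel s t}.
Proof.
move=> [bs ms ps]; have [fs injs surjs] := bs.
have /choice[t tP] : forall y, exists x, `[0, 1]%classic y -> `[0, 1]%classic x /\ s x = y.
  move=> y; have [y01|y01] := pselect (`[0, 1]%classic y); last by exists 0.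
  by have [x x01 sx] := surjs _ y01; exists x.
have ft : set_fun `[0, 1] `[0, 1] t by move=> y /tP[].
have ts : {in `[0, 1]%classic, cancel t s} by move=> y /[!inE] /tP[].
have st : {in `[0, 1]%classic, cancel s t}.
  move=> x x01; apply: injs => //; first by rewrite inE; apply/ft/fs; rewrite inE in x01.
  by rewrite ts// inE; apply: fs; rewrite inE in x01.
have imt A : A `<=` `[0, 1] -> t @` A = `[0, 1] `&` s @^-1` A.
  move=> A01; apply/seteqP; split => [_ [y Ay <-]|x [x01 sx]].
    by split; [exact/ft/A01|rewrite /= ts// inE; exact: A01].
  by exists (s x) => //; rewrite st// inE.
have prt A : A `<=` `[0, 1] -> `[0, 1] `&` t @^-1` A = s @` A.
  move=> A01; apply/seteqP; split => [y [y01 ty]|_ [x Ax <-]].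
    by exists (t y) => //; rewrite ts// inE.
  by split; [exact/fs/A01|rewrite /= st// inE; exact: A01].
exists t => //; split.
- split => // [y y' /[!inE] y01 y'01 tyy'|x x01].
    by rewrite -(ts y) ?inE// tyy' ts// inE.
  by exists (s x); [exact: fs|rewrite st// inE].
- move=> _ A mA.
  have -> : `[0, 1] `&` t @^-1` A = `[0, 1] `&` t @^-1` (A `&` `[0, 1]).
    by apply/seteqP; split => y [y01 ty]; split => //; [split => //; exact: ft|case: ty].
  rewrite prt; last by move=> x [].
  by apply: (ps _ _ _).1; [exact: measurableI|move=> x []].
- move=> A mA A01; split.
    by rewrite imt//; exact: ms.
  have [msA sAE] := ps _ mA A01.
  have sA01 : s @` A `<=` `[0, 1] by move=> _ [x /A01 x01 <-]; exact: fs.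
  rewrite prt// -(ps _ msA sA01).2; congr (leb1 R _); apply/seteqP; split.
    move=> x [x01 [y Ay sxy]]; rewrite -(injs y x)// inE//; exact: A01.
  by move=> x Ax; split; [exact: A01|exists x].
Qed.

(** Off the square neither [f] nor [s] is controlled. The right-hand side is a composite that is
    measurable on the whole plane as soon as [f] is measurable on the square. *)
Let permuteE f s : mp_bijection s ->
  {in sqr01, permute f s =1 (f \_ sqr01) \o mp_ext2 s}.
Proof.
move=> [[fs _ _] _ _] z /[!inE] -[z1 z2].
rewrite /= /mp_ext2 !mp_ext_in// patchE ifT// inE; split => /=; exact: fs.
Qed.

Let preimage_image s A : mp_bijection s -> A `<=` `[0, 1] ->
  mp_ext s @^-1` (s @` A) = A.
Proof.
move=> [[fs injs _] _ _] A01; apply/seteqP; split => [x [a Aa]|x Ax]; last first.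
  by exists x => //; rewrite mp_ext_in//; exact: A01.
have [x01|x01] := pselect (`[0, 1]%classic x).
  by rewrite mp_ext_in// => /injs <- //; rewrite inE//; exact: A01.
rewrite /mp_ext ifF; last exact/negbTE/negP.
by move=> sax; exfalso; apply: x01; rewrite -sax; exact/fs/A01.
Qed.

(** By injectivity [A] and [B] are the preimages of their images, so this is the change of variables
    [mp_ext2 s] over the image rectangle. *)
Lemma Rintegral_permute f s A B : mp_bijection s ->
  (leb2 R).-integrable sqr01 (EFin \o f) ->
  measurable A -> measurable B -> A `<=` `[0, 1] -> B `<=` `[0, 1] ->
  \int[leb2 R]_(z in A `*` B) permute f s z =
  \int[leb2 R]_(z in (s @` A) `*` (s @` B)) f z.
Proof.
move=> sP fi mA mB A01 B01; have [[fs _ _] _ ps] := sP.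
have sub01 C : C `<=` `[0, 1] -> s @` C `<=` `[0, 1].
  by move=> C01 _ [x Cx <-]; exact/fs/C01.
have msAB : measurable ((s @` A : set (mR R)) `*` (s @` B : set (mR R))).
  by apply: measurableX; [exact: (ps _ mA A01).1|exact: (ps _ mB B01).1].
have sABQ := sub_sqr01 (sub01 _ A01) (sub01 _ B01).
transitivity (\int[leb2 R]_(z in (s @` A) `*` (s @` B)) (f \_ sqr01) z); last first.
  by apply: eq_Rintegral => z /[!inE] /sABQ Qz; rewrite patchE ifT// inE.
have fQi : (leb2 R).-integrable setT (EFin \o (f \_ sqr01)).
  by rewrite -restrict_EFin; exact: (iffLR (integrable_mkcond _ measurable_sqr01) fi).
rewrite -(integral_mp_ext2 sP msAB).
- rewrite (_ : mp_ext2 s @^-1` _ = (mp_ext s @^-1` (s @` A)) `*` (mp_ext s @^-1` (s @` B)))//.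
  rewrite !preimage_image//; apply: eq_Rintegral => z /[!inE] /(sub_sqr01 A01 B01) Qz.
  by rewrite permuteE// inE.
- by apply/measurable_EFinP; exact: measurable_int fQi.
- by apply: integrableS fQi => //.
Qed.

Lemma permute_S0 f s : S0 f -> mp_bijection s -> S0 (permute f s).
Proof.
move=> [mf f01] sP; split.
  apply: (eq_measurable_fun ((f \_ sqr01) \o mp_ext2 s)).
    by move=> z Qz; exact: (esym (permuteE f sP Qz)).
  apply: measurable_funTS; apply: measurableT_comp; last exact: measurable_mp_ext2.
  by apply/(measurable_restrictT _ measurable_sqr01).
have [N [mN N0 fN]] := f01; have ms := measurable_mp_ext2 sP.
exists (mp_ext2 s @^-1` N); split.
- by rewrite -[X in measurable X]setTI; exact: ms.
- by rewrite [LHS]leb2_preimage_mp_ext2.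
- move=> z /= /not_implyP[Qz fz]; apply: fN => /=; apply/not_implyP.
  have [[fs _ _] _ _] := sP; move: Qz => [z1 z2].
  by rewrite /mp_ext2 !mp_ext_in//; split => //; split => /=; exact: fs.
Qed.

(** A measure-preserving bijection sends measurable rectangles to measurable rectangles, so each
    value in the supremum on the left also occurs on the right. *)
Lemma dcut_permute f g s : S0 f -> S0 g -> mp_bijection s ->
  dcut (permute f s) (permute g s) <= dcut f g.
Proof.
move=> Sf Sg sP; apply: dcut_le => A B mA mB A01 B01.
have [[fs _ _] _ ps] := sP.
have sub01 C : C `<=` `[0, 1] -> s @` C `<=` `[0, 1].
  by move=> C01 _ [x Cx <-]; exact/fs/C01.
have /= -> := Rintegral_permute sP (S0_integrableB Sf Sg) mA mB A01 B01.
have msA := (ps _ mA A01).1; have msB := (ps _ mB B01).1.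
by apply: dcut_ge => //; exact: sub01.
Qed.

Lemma Rintegral_permute_sqr01 f s : S0 f -> mp_bijection s ->
  \int[leb2 R]_(z in sqr01) permute f s z = \int[leb2 R]_(z in sqr01) f z.
Proof.
move=> Sf sP; rewrite /sqr01.
rewrite (Rintegral_permute sP (S0_integrable Sf))//.
have [[fs _ surjs] _ _] := sP.
suff -> : s @` `[0, 1] = `[0, 1]%classic by [].
by apply/seteqP; split => // _ [x x01 <-]; exact: fs.
Qed.

(** [cut_equiv f g] unfolds to [dmp f g = 0], and by [deltacut_hat] this is the distance between
    classes. Working with [dmp] on representatives avoids handling the classes themselves. *)
Definition dmp f g : R := inf [set dcut f (permute g s) | s in mp_bijection].

Let dmp_has_lbound f g : S0 f -> S0 g ->
  has_lbound [set dcut f (permute g s) | s in mp_bijection].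
Proof.
by move=> Sf Sg; exists 0 => _ [s sP <-]; apply: dcut_ge0 => //; exact: permute_S0.
Qed.

Lemma dmp_le f g s : S0 f -> S0 g -> mp_bijection s ->
  dmp f g <= dcut f (permute g s).
Proof. by move=> Sf Sg sP; apply: ge_inf; [exact: dmp_has_lbound|exists s]. Qed.

Lemma dmp_approx f g e : S0 f -> S0 g -> 0 < e ->
  exists2 s, mp_bijection s & dcut f (permute g s) < dmp f g + e.
Proof.
move=> Sf Sg e0.
have [|_ [s sP <-] h] := @inf_adherent _ [set dcut f (permute g s) | s in mp_bijection] _ e0.
  split; last exact: dmp_has_lbound.
  by exists (dcut f (permute g idfun)); exists idfun => //; exact: mp_bijection_id.
by exists s.
Qed.

Lemma dmp_le_dcut f g : S0 f -> S0 g -> dmp f g <= dcut f g.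
Proof.
move=> Sf Sg; apply: le_trans (dmp_le Sf Sg mp_bijection_id) _.
by rewrite (@eq_dcut _ f (permute g idfun) f g)// => -[].
Qed.

Lemma dmp_ge0 f g : S0 f -> S0 g -> 0 <= dmp f g.
Proof.
move=> Sf Sg; apply/ler_addgt0Pr => e e0.
have [s sP /ltW] := dmp_approx Sf Sg e0; apply: le_trans.
by apply: dcut_ge0 => //; exact: permute_S0.
Qed.

Lemma dmpxx f : S0 f -> dmp f f = 0.
Proof.
move=> Sf; apply/eqP; rewrite eq_le dmp_ge0// andbT.
apply: le_trans (dmp_le_dcut Sf Sf) _; apply: le_trans (dcut_le_L1 Sf Sf) _.
by under eq_Rintegral do rewrite subrr normr0; rewrite Rintegral_cst// mul0r.
Qed.

(** If [s] brings [f] close to [g], applying the inverse of [s] to both sides brings [g] close to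
    [f], without increasing [dcut]. *)
Let dmpC_le f g : S0 f -> S0 g -> dmp f g <= dmp g f.
Proof.
move=> Sf Sg; apply/ler_addgt0Pr => e e0.
have [s sP /ltW] := dmp_approx Sg Sf e0; apply: le_trans.
have [t tP [st ts]] := mp_bijection_inv sP.
apply: le_trans (dmp_le Sf Sg tP) _.
rewrite (@eq_dcut _ f (permute g t) (permute (permute f s) t) (permute g t))//; last first.
  move=> z /[!inE] -[z1 z2].
  by rewrite /permute/= !st ?inE//; case: z z1 z2.
rewrite (dcutC Sg (permute_S0 Sf sP)).
exact: dcut_permute (permute_S0 Sf sP) Sg tP.
Qed.

Lemma dmpC f g : S0 f -> S0 g -> dmp f g = dmp g f.
Proof. by move=> Sf Sg; apply/le_anti/andP; split; exact: dmpC_le. Qed.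

(** Almost optimal bijections [s] for the pair [f], [g] and [t] for the pair [g], [h] are composed:
    the second comparison is transported by [s], at no cost by [dcut_permute]. *)
Lemma dmp_triangle g f h : S0 f -> S0 g -> S0 h ->
  dmp f h <= dmp f g + dmp g h.
Proof.
move=> Sf Sg Sh; apply/ler_addgt0Pr => e e0.
have e20 : 0 < e / 2 by rewrite divr_gt0.
have [s sP hs] := dmp_approx Sf Sg e20.
have [t tP ht] := dmp_approx Sg Sh e20.
have Sgs := permute_S0 Sg sP; have Sht := permute_S0 Sh tP.
apply: le_trans (dmp_le Sf Sh (mp_bijection_comp sP tP)) _.
apply: le_trans (dcut_triangle Sf Sgs (permute_S0 Sht sP)) _.
rewrite [e]splitr addrACA; apply: lerD (ltW hs) _.
exact: le_trans (dcut_permute Sg Sht sP) (ltW ht).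
Qed.

(** The integral over the square is invariant under permutation and 1-Lipschitz for [dcut]. It is
    therefore well defined and continuous on classes. *)
Lemma Rintegral_dmp f g : S0 f -> S0 g ->
  `|\int[leb2 R]_(z in sqr01) f z - \int[leb2 R]_(z in sqr01) g z| <= dmp f g.
Proof.
move=> Sf Sg; apply/ler_addgt0Pr => e e0.
have [s sP /ltW] := dmp_approx Sf Sg e0; apply: le_trans.
by rewrite -(Rintegral_permute_sqr01 Sg sP); apply: Rintegral_dcut => //; exact: permute_S0.
Qed.

Lemma hat_refl f : S0 f -> hat f f.
Proof. by move=> Sf; split => //; exact: dmpxx. Qed.

(** Members of the classes are at [dmp] distance zero from [f] and [g], so the triangle inequality
    bounds the infimum from below. For the upper bound, [permute g s] lies in the class of [g], as
    undoing [s] shows. *)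
Lemma deltacut_hat f g : S0 f -> S0 g -> deltacut (hat f) (hat g) = dmp f g.
Proof.
move=> Sf Sg.
have lb : lbound [set dcut f' g' | f' in hat f & g' in hat g] (dmp f g).
  move=> _ [f' [Sf' ff']] [g' [Sg' gg']] <-.
  have e1 : dmp f f' = 0 := ff'.
  have e2 : dmp g' g = 0 by rewrite (dmpC Sg' Sg); exact: gg'.
  apply: le_trans (dmp_triangle Sf Sf' Sg) _; rewrite e1 add0r.
  apply: le_trans (dmp_triangle Sf' Sg' Sg) _; rewrite e2 addr0.
  exact: dmp_le_dcut.
apply/eqP; rewrite eq_le; apply/andP; split; last first.
  apply: lb_le_inf => //; exists (dcut f g), f; first exact: hat_refl.
  by exists g => //; exact: hat_refl.
apply/ler_addgt0Pr => e e0; have [s sP /ltW] := dmp_approx Sf Sg e0.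
apply: le_trans; apply: ge_inf; first by exists (dmp f g).
exists f; first exact: hat_refl; exists (permute g s) => //.
split; first exact: permute_S0.
have [t tP [st ts]] := mp_bijection_inv sP.
rewrite /cut_equiv -/(dmp g (permute g s)).
apply/le_anti/andP; split; last exact: dmp_ge0 Sg (permute_S0 Sg sP).
apply: le_trans (dmp_le Sg (permute_S0 Sg sP) tP) _.
rewrite (@eq_dcut _ g (permute (permute g s) t) g g)//; last first.
  move=> z /[!inE] -[z1 z2].
  by rewrite /permute/= !st ?inE//; case: z z1 z2.
apply: le_trans (dcut_le_L1 Sg Sg) _.
by under eq_Rintegral do rewrite subrr normr0; rewrite Rintegral_cst// mul0r.
Qed.

Lemma hat_eq f g : S0 f -> S0 g -> dmp f g = 0 -> hat f = hat g.
Proof.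
suff sub (u v : R * R -> R) : S0 u -> S0 v -> dmp u v = 0 -> hat u `<=` hat v.
  move=> Sf Sg fg; apply/seteqP; split; first exact: sub.
  by apply: (sub g f Sg Sf); rewrite (dmpC Sg Sf); exact: fg.
move=> Su Sv uv h [Sh uh]; split; first exact: Sh.
have e1 : dmp u h = 0 := uh.
rewrite /cut_equiv -/(dmp v h); apply/le_anti/andP; split; last exact: dmp_ge0.
by apply: le_trans (dmp_triangle Sv Su Sh) _; rewrite (dmpC Sv Su) uv e1 addr0.
Qed.

Lemma edge_density_hat f : S0 f ->
  edge_density (hat f) = \int[leb2 R]_(z in sqr01) f z.
Proof.
move=> Sf; rewrite /edge_density.
have [Sg fg] : hat f (get (hat f)) by apply: (@getI _ (hat f) f); exact: hat_refl.
have := Rintegral_dmp Sf Sg; rewrite /dmp fg normr_le0 subr_eq0.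
by move=> /eqP ->.
Qed.

End cut_metric.

(** * Convexity of the rate integrand and the Lagrange multiplier *)

Definition lagr {R : realType} (p m x : R) : R :=
  (Num.sqrt (p * (1 - x)) - Num.sqrt (m * x)) ^+ 2.

Definition tilt {R : realType} (p m l : R) : R :=
  2^-1 + (p - m + l) / (2 * Num.sqrt ((p - m + l) ^+ 2 + 4 * p * m)).

Section convexity.
Context {R : realType}.
Implicit Types p m l x c : R.

(** Expanding the square leaves an affine function of [x] minus a multiple of [sqrt (x (1 - x))],
    which alone carries the convexity. *)
Lemma lagrE p m x : 0 <= p -> 0 <= m -> 0 <= x <= 1 ->
  lagr p m x = p * (1 - x) + m * x
    - 2 * Num.sqrt (p * m) * Num.sqrt (x * (1 - x)).
Proof.
move=> p0 m0 /andP[x0 x1]; rewrite /lagr sqrrB !sqr_sqrtr; first last.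
- by rewrite mulr_ge0// subr_ge0.
- by rewrite mulr_ge0.
have -> : Num.sqrt (p * (1 - x)) * Num.sqrt (m * x) =
    Num.sqrt (p * m) * Num.sqrt (x * (1 - x)).
  rewrite -!sqrtrM ?mulr_ge0 ?subr_ge0//; congr Num.sqrt; ring.
ring.
Qed.

Lemma lagr_ge0 p m x : 0 <= lagr p m x.
Proof. exact: sqr_ge0. Qed.

(** Provides the majorant [gp + gm] that makes the rate integrand integrable. *)
Lemma lagr_le p m x : 0 <= p -> 0 <= m -> 0 <= x <= 1 -> lagr p m x <= p + m.
Proof.
move=> p0 m0 x01; rewrite lagrE//.
have := mulr_ge0 (sqrtr_ge0 (p * m)) (sqrtr_ge0 (x * (1 - x))).
by move: x01 => /andP[]; nra.
Qed.

Lemma tilt01 p m l : 0 <= p -> 0 <= m -> 0 <= tilt p m l <= 1.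
Proof.
move=> p0 m0; rewrite /tilt; set a := p - m + l.
have aS : `|a| <= Num.sqrt (a ^+ 2 + 4 * p * m).
  by rewrite -sqrtr_sqr ler_sqrt; nra.
(* If the root vanishes, the quotient is [0] because the inverse of [0] is [0], and [tilt] equals
   one half. *)
have [->|S0] := eqVneq (Num.sqrt (a ^+ 2 + 4 * p * m)) 0.
  by rewrite mulr0 invr0 mulr0; lra.
have S_gt0 : 0 < Num.sqrt (a ^+ 2 + 4 * p * m) by rewrite lt_def S0 sqrtr_ge0.
have : `|a / (2 * Num.sqrt (a ^+ 2 + 4 * p * m))| <= 2^-1.
  rewrite normrM normfV [X in _ / X]ger0_norm ?mulr_ge0 ?sqrtr_ge0//.
  by rewrite ler_pdivrMr ?mulr_gt0// mulrA mulVf// mul1r.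
by rewrite ler_norml; lra.
Qed.

(* [tilt p m l] is the point [f] where [lagr p m] has slope [l], and the exact
   remainder is [S ((x - f)^2 + (sqrt (x (1 - x)) - sqrt (f (1 - f)))^2)], where
   [S >= 2 sqrt (p m) >= 2 c]. *)
Lemma lagr_tilt_ge p m l c x : 0 < c -> c <= p -> c <= m -> 0 <= x <= 1 ->
  lagr p m (tilt p m l) + l * (x - tilt p m l) + 2 * c * (x - tilt p m l) ^+ 2
  <= lagr p m x.
Proof.
move=> c0 cp cm x01.
have p0 : 0 < p by lra.
have m0 : 0 < m by lra.
have f01 := tilt01 l (ltW p0) (ltW m0).
rewrite (lagrE (ltW p0) (ltW m0) x01) (lagrE (ltW p0) (ltW m0) f01).
set k := Num.sqrt (p * m); set a := p - m + l.
set S := Num.sqrt (a ^+ 2 + 4 * p * m).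
have S2 : S ^+ 2 = a ^+ 2 + 4 * p * m by rewrite sqr_sqrtr//; nra.
have S0 : 0 < S by rewrite sqrtr_gt0; nra.
have k2 : k ^+ 2 = p * m by rewrite sqr_sqrtr//; nra.
have k0 : 0 <= k by exact: sqrtr_ge0.
have ck : c <= k by rewrite -[c]ger0_norm ?(ltW c0)// -sqrtr_sqr ler_sqrt; nra.
have kS : 2 * k <= S.
  rewrite -[2 * k]ger0_norm ?mulr_ge0// -sqrtr_sqr /S ler_sqrt; last by nra.
  by rewrite exprMn k2; nra.
move: f01; rewrite /tilt -/a -/S; set f := (_ + a / _) => f01.
have aE : a = S * (2 * f - 1) by rewrite /f; field; lra.
(* As [2 f - 1 = a / S], one has [4 f (1 - f) = (S^2 - a^2) / S^2], and
   [S^2 - a^2 = 4 p m = 4 k^2]. *)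
have GE : Num.sqrt (f * (1 - f)) = k / S.
  rewrite -[k / S]ger0_norm ?divr_ge0 ?(ltW S0)// -sqrtr_sqr.
  congr (Num.sqrt _); rewrite expr_div_n k2.
  have -> : p * m = (S ^+ 2 - a ^+ 2) / 4 by rewrite S2; field.
  by rewrite aE; field; lra.
have kE : k = S * Num.sqrt (f * (1 - f)) by rewrite GE; field; lra.
have G2 : Num.sqrt (f * (1 - f)) ^+ 2 = f * (1 - f).
  by rewrite sqr_sqrtr//; move: f01; nra.
have X2 : Num.sqrt (x * (1 - x)) ^+ 2 = x * (1 - x).
  by rewrite sqr_sqrtr//; move: x01; nra.
move: kE G2 X2 {GE}.
set G := Num.sqrt (f * _); set X := Num.sqrt (x * _) => kE G2 X2.
have lE : l = a - p + m by rewrite /a; ring.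
rewrite -subr_ge0 [leRHS](_ : _ = S * ((x - f) ^+ 2 + (X - G) ^+ 2)
   - 2 * c * (x - f) ^+ 2); last first.
  rewrite lE aE kE.
  (* The relations [G^2 = f (1 - f)] and [X^2 = x (1 - x)] are carried along as explicit
     differences: the first two equalities are polynomial identities, and the relations are used
     only in the last one. *)
  transitivity (S * (x + f - 2 * x * f - 2 * G * X + 2 * (G ^+ 2 - f * (1 - f)))
     - 2 * c * (x - f) ^+ 2); first by ring.
  transitivity (S * ((x - f) ^+ 2 + X ^+ 2 + G ^+ 2 - 2 * G * X
     + (x * (1 - x) - X ^+ 2) + (f * (1 - f) - G ^+ 2)
     + 2 * (G ^+ 2 - f * (1 - f)))
     - 2 * c * (x - f) ^+ 2); first by ring.
  by rewrite -G2 -X2; ring.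
have := sqr_ge0 (x - f); have := sqr_ge0 (X - G); nra.
Qed.

Lemma tilt0 p m : 0 < p -> 0 < m -> tilt p m 0 = p / (p + m).
Proof.
move=> p0 m0; rewrite /tilt addr0.
have -> : (p - m) ^+ 2 + 4 * p * m = (p + m) ^+ 2 by ring.
by rewrite sqrtr_sqr ger0_norm; [field|]; lra.
Qed.

(** At [x = p / (p + m)] the two arguments [p (1 - x)] and [m x] of the square roots coincide. *)
Lemma lagr_tilt0 p m : 0 < p -> 0 < m -> lagr p m (tilt p m 0) = 0.
Proof.
move=> p0 m0; rewrite tilt0// /lagr (_ : p * _ = m * (p / (p + m))).
  by rewrite subrr expr0n.
by field; lra.
Qed.

(** Write [a] and [b] for the points of slope [l1] and [l2]. The sum of the tangent inequality at
    [a] evaluated at [b] and of the one at [b] evaluated at [a] is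
    [4 c (b - a)^2 <= (l2 - l1) (b - a)], which gives both bounds. *)
Lemma tilt_mono_lip p m c l1 l2 : 0 < c -> c <= p -> c <= m -> l1 <= l2 ->
  0 <= tilt p m l2 - tilt p m l1 <= (l2 - l1) / (4 * c).
Proof.
move=> c0 cp cm l12.
have p0 : 0 <= p by lra.
have m0 : 0 <= m by lra.
have := lagr_tilt_ge l1 c0 cp cm (tilt01 l2 p0 m0).
have := lagr_tilt_ge l2 c0 cp cm (tilt01 l1 p0 m0).
set a := tilt p m l1; set b := tilt p m l2 => h1 h2.
have h : 4 * c * (b - a) ^+ 2 <= (l2 - l1) * (b - a) by nra.
have ab : 0 <= b - a.
  rewrite leNgt; apply/negP => ba.
  have : 0 < (b - a) ^+ 2 by rewrite exprn_even_gt0//=; lra.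
  nra.
rewrite ab /= ler_pdivlMr; last lra.
have [->|ab0] := eqVneq (b - a) 0; first by nra.
have {}ab : 0 < b - a by rewrite lt_def ab0.
by rewrite -(ler_pM2r ab); nra.
Qed.

(* The tangent inequality at [x = 1], where [lagr p m 1 = m]. *)
Lemma tilt_ge p m c l : 0 < c -> c <= p -> c <= m -> 0 < l ->
  1 - m / l <= tilt p m l.
Proof.
move=> c0 cp cm l0.
have p0 : 0 <= p by lra.
have m0 : 0 <= m by lra.
have /(lagr_tilt_ge l c0 cp cm) : 0 <= (1 : R) <= 1 by rewrite ler01 lexx.
rewrite [leRHS]lagrE ?ler01 ?lexx// !subrr !mulr0 sqrtr0.
have := lagr_ge0 p m (tilt p m l); set f := tilt p m l => L0 h.
have : l * (1 - f) <= m by have := sqr_ge0 (1 - f); nra.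
by rewrite mulrC -ler_pdivlMr//; lra.
Qed.

End convexity.

(** * The Lagrange multiplier for a prescribed edge density *)

Definition rates {R : realType} (gp gm : R * R -> R) (c : R) : Prop :=
  [/\ 0 < c, forall z, sqr01 z -> 0 <= gp z /\ 0 <= gm z,
      (leb2 R).-integrable sqr01 (EFin \o gp) /\
      (leb2 R).-integrable sqr01 (EFin \o gm) &
      {ae leb2 R, forall z, sqr01 z -> c <= gp z /\ c <= gm z}].

Section multiplier.
Context {R : realType} (gp gm : R * R -> R) (c : R) (H : rates gp gm c).

Lemma measurable_rates :
  measurable_fun (sqr01 : set (mR R * mR R)) (gp : mR R * mR R -> R) /\
  measurable_fun (sqr01 : set (mR R * mR R)) (gm : mR R * mR R -> R).
Proof.
by case: H => _ _ [/measurable_int/measurable_EFinP ? /measurable_int/measurable_EFinP ?] _.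
Qed.

(** On nonnegative reals the inverse is the power with exponent [-1], a measurable function; at [0]
    both are [0]. *)
Lemma measurable_fun_div_ge0 d (T : measurableType d) (D : set T) (f g : T -> R) :
  measurable_fun D f -> measurable_fun D g -> (forall x, D x -> 0 <= g x) ->
  measurable_fun D (fun x => f x / g x).
Proof.
move=> mf mg g0; apply: (eq_measurable_fun (fun x => f x * (g x `^ (-1)))).
  by move=> x /[!inE] /g0 gx; rewrite powR_inv1.
have mV : measurable_fun setT (fun x : R => x `^ (-1)) by exact: measurable_powR.
exact: (measurable_funM mf (measurableT_comp mV mg)).
Qed.

Lemma measurable_fun_sqrt d (T : measurableType d) (D : set T) (f : T -> R) :
  measurable_fun D f -> measurable_fun D (fun x => Num.sqrt (f x)).
Proof.
move=> mf; have ms : measurable_fun setT (@Num.sqrt R).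
  by apply: continuous_measurable_fun; exact: sqrt_continuous.
exact: (measurableT_comp ms mf).
Qed.

Lemma f_lambdaE l z : f_lambda gp gm l z = tilt (gp z) (gm z) l.
Proof. by []. Qed.

Lemma f_lambda01 l z : sqr01 z -> 0 <= f_lambda gp gm l z <= 1.
Proof. by case: H => _ g0 _ _ /g0[? ?]; rewrite f_lambdaE tilt01. Qed.

Lemma S0_f_lambda l : S0 (f_lambda gp gm l).
Proof.
have [mp mm] := measurable_rates; split; last exact/aeW/f_lambda01.
apply: measurable_funD => //; apply: measurable_fun_div_ge0.
- by apply: measurable_funD => //; exact: measurable_funB.
- apply: measurable_funM => //; apply: measurable_fun_sqrt.
  apply: measurable_funD.
    by apply: measurable_funX; apply: measurable_funD => //; exact: measurable_funB.
  by apply: measurable_funM => //; exact: measurable_funM.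
- by move=> z _; rewrite mulr_ge0.
Qed.

Lemma S0_wstar : S0 (wstar gp gm).
Proof.
have [mp mm] := measurable_rates; case: H => c0 g0 _ _; split.
  apply: measurable_fun_div_ge0 => //; first exact: measurable_funD.
  by move=> z /g0[? ?]; rewrite addr_ge0.
apply: aeW => z /g0[p0 m0]; rewrite /wstar divr_ge0 ?addr_ge0//=.
have [->|s0] := eqVneq (gp z + gm z) 0; first by rewrite invr0 mulr0.
by rewrite ler_pdivrMr ?lt_def ?s0 ?addr_ge0// mul1r lerDl.
Qed.

Lemma wstar_f_lambda0 :
  {ae leb2 R, forall z, sqr01 z -> wstar gp gm z = f_lambda gp gm 0 z}.
Proof.
case: H => c0 _ _; apply: filterS => z /= h /h[p0 m0].
by rewrite f_lambdaE tilt0//; lra.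
Qed.

Let F l := \int[leb2 R]_(z in sqr01) f_lambda gp gm l z.

Let F0 : F 0 = pstar gp gm.
Proof.
apply: ae_eq_Rintegral => //; [exact: (S0_f_lambda _).1|exact: S0_wstar.1|].
by apply: filterS wstar_f_lambda0 => z /= h /h ->.
Qed.

Let F_mono_lip l1 l2 : l1 <= l2 -> 0 <= F l2 - F l1 <= (l2 - l1) / (4 * c).
Proof.
move=> l12; rewrite /F -RintegralB//; try exact: S0_integrable (S0_f_lambda _).
have ii := S0_integrableB (S0_f_lambda l2) (S0_f_lambda l1).
rewrite -[X in X <= _ <= _](Rintegral_cst_sqr01 0).
rewrite -[X in _ <= _ <= X](Rintegral_cst_sqr01 ((l2 - l1) / (4 * c))).
case: H => c0 _ _ hc.
apply/andP; split; apply: ae_le_Rintegral => //; try exact: integrable_cst_sqr01;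
  apply: filterS hc => z /= h /h[cp cm];
  by have /andP[] := tilt_mono_lip c0 cp cm l12.
Qed.

(** The lower bound tends to [1] as [l] grows, so [F] eventually exceeds any prescribed mean below
    [1]. *)
Let F_ge l : 0 < l -> 1 - (\int[leb2 R]_(z in sqr01) gm z) / l <= F l.
Proof.
move=> l0; case: H => c0 _ [_ gmi] hc.
have gli : (leb2 R).-integrable sqr01 (EFin \o (fun z => gm z / l)).
  by apply: eq_integrable (integrableZr measurable_sqr01 l^-1 gmi).
rewrite -[X in X - _ <= _](Rintegral_cst_sqr01 1) -RintegralZr//.
rewrite -RintegralB//; last exact: integrable_cst_sqr01.
apply: ae_le_Rintegral => //.
- have := integrableB measurable_sqr01 (integrable_cst_sqr01 1) gli; exact.
- exact: S0_integrable (S0_f_lambda _).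
- by apply: filterS hc => z /= h /h[cp cm]; exact: (tilt_ge c0).
Qed.

Lemma lambda_deltaP delta : 0 < delta < 1 - pstar gp gm ->
  0 <= lambda_delta gp gm delta /\
  \int[leb2 R]_(z in sqr01) fstar gp gm delta z = pstar gp gm + delta.
Proof.
move=> /andP[d0 d1].
have [c0 _ _ _] := H.
set G := \int[leb2 R]_(z in sqr01) gm z.
have G0 : 0 <= G by apply: Rintegral_ge0 => z Qz; case: H => _ /(_ _ Qz)[].
set r := 1 - pstar gp gm - delta.
have r0 : 0 < r by rewrite /r; lra.
(* Chosen so that [G / b <= r], hence [F b >= 1 - r = pstar + delta]. The [+ 1] keeps [b] positive
   even if [G] is zero. *)
pose b := (G + 1) / r.
have b0 : 0 < b by rewrite divr_gt0//; lra.
have Fb : pstar gp gm + delta <= F b.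
  apply: le_trans (F_ge b0); rewrite -/G.
  have : G / b <= r.
    by rewrite ler_pdivrMr// /b mulrCA divff ?gt_eqF// mulr1; lra.
  by rewrite /r; lra.
have cF : continuous F.
  move=> x; apply/cvgrPdist_lt => e e0; near=> y.
  have k0 : 0 < (4 * c)^-1 by rewrite invr_gt0; lra.
  have : `|F x - F y| <= `|x - y| / (4 * c).
    have [/F_mono_lip|/ltW /F_mono_lip] := leP x y.
      move=> /andP[F1 F2]; rewrite distrC ger0_norm// (le_trans F2)//.
      by rewrite ler_pM2r// distrC ler_norm.
    move=> /andP[F1 F2]; rewrite ger0_norm// (le_trans F2)//.
    by rewrite ler_pM2r// ler_norm.
  move=> /le_lt_trans; apply; rewrite ltr_pdivrMr; last lra.
  near: y; apply/nbhs_ballP; exists (e * (4 * c)) => //=.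
  by rewrite mulr_gt0//; lra.
have [l l0b Fl] : exists2 l, l \in `[0, b] & F l = pstar gp gm + delta.
  apply: IVT; [exact: ltW|exact: continuous_subspaceT|].
  by rewrite F0 ge_min le_max; lra.
have FL : F (lambda_delta gp gm delta) = pstar gp gm + delta.
  by apply: (@getI _ [set l | F l = pstar gp gm + delta] l).
(* By monotonicity of [F], a negative multiplier would give a mean of at most [F 0 = pstar], which
   is below [pstar + delta]. *)
split => //; rewrite leNgt; apply/negP => /ltW/F_mono_lip.
by rewrite FL F0; lra.
Unshelve. all: by end_near.
Qed.

End multiplier.

(** * Averages over time windows *)

Section window.
Context {R : realType} (T : R) (eps : R).
Hypotheses (T0 : 0 < T) (eps0 : 0 < eps).
Implicit Types t s : time T.

Lemma time_itv t : 0 <= (\val t : R) <= T.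
Proof. by have := set_valP t; rewrite /= in_itv. Qed.

Let lo t : R := Num.max (\val t - eps) 0.
Let hi t : R := Num.min (\val t + eps) T.

Let U_itv t : U eps t = `[lo t, hi t]%classic.
Proof.
apply/seteqP; split => x; rewrite /U /= !in_itv /= /lo /hi ge_max le_min.
  by move=> [/andP[-> ->] /andP[-> ->]].
by move=> /andP[/andP[-> ->] /andP[-> ->]].
Qed.

Lemma measurable_U t : measurable (U eps t : set (mR R)).
Proof. by rewrite U_itv; exact: measurable_itv. Qed.

Let lo_lt_hi t : lo t < hi t.
Proof.
have e0 := eps0; have T1 := T0; have /andP[t0 tT] := time_itv t.
by rewrite /lo /hi lt_min !gt_max; lra.
Qed.

Lemma leb1_U t : leb1 R (U eps t) = (lenU eps t)%:E.
Proof. by rewrite /lenU U_itv leb1_itvcc// ltW. Qed.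

Let lenUE t : lenU eps t = hi t - lo t.
Proof. by rewrite /lenU U_itv leb1_itvcc// ltW. Qed.

Lemma lenU_gt0 t : 0 < lenU eps t.
Proof. by rewrite lenUE subr_gt0. Qed.

(** The length of the intersection of two windows, with the maximum covering disjoint windows.
    Written with minima and maxima of the endpoints, it is visibly continuous in [t]. *)
Let ov t0 t : R := Num.max (Num.min (hi t) (hi t0) - Num.max (lo t) (lo t0)) 0.

Let leb1_UI t0 t : leb1 R (U eps t `&` U eps t0) = (ov t0 t)%:E.
Proof.
have -> : U eps t `&` U eps t0 =
    `[Num.max (lo t) (lo t0), Num.min (hi t) (hi t0)]%classic.
  rewrite !U_itv; apply/seteqP; split => x.
    by move=> [/itvP lx /itvP rx]; rewrite /= in_itv/= ge_max le_min !lx !rx.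
  rewrite /= !in_itv/= => /andP[]; rewrite ge_max le_min.
  by move=> /andP[-> ->] /andP[-> ->].
rewrite lebesgue_measure_itv/= lte_fin /ov; case: ltP => h.
  by rewrite -EFinD; congr EFin; apply/esym/max_idPl; rewrite subr_ge0 ltW.
by congr EFin; apply/esym/max_idPr; rewrite subr_le0.
Qed.

(** The fraction of the window around [t] that is covered by the window around [t0]. All time
    dependence of the averaged optimizer passes through this number. *)
Definition overlap t0 t : R := fine (leb1 R (U eps t `&` U eps t0)) / lenU eps t.

Let cvg_maxr (X : Type) (F : set_system X) {FF : Filter F} (f g : X -> R) (a b : R) :
  f @ F --> a -> g @ F --> b -> Num.max (f x) (g x) @[x --> F] --> Num.max a b.
Proof.
move=> fa gb; rewrite maxr_absE; under eq_fun do rewrite maxr_absE.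
apply: cvgMl; apply: cvgD; first exact: cvgD.
by apply: cvg_norm; exact: cvgB.
Qed.

Let cvg_minr (X : Type) (F : set_system X) {FF : Filter F} (f g : X -> R) (a b : R) :
  f @ F --> a -> g @ F --> b -> Num.min (f x) (g x) @[x --> F] --> Num.min a b.
Proof.
move=> fa gb; rewrite minr_absE; under eq_fun do rewrite minr_absE.
apply: cvgMl; apply: cvgB; first exact: cvgD.
by apply: cvg_norm; exact: cvgB.
Qed.

Lemma continuous_val : continuous (fun t => \val t).
Proof. exact: initial_continuous. Qed.

Lemma continuous_overlap t0 : continuous (overlap t0).
Proof.
have -> : overlap t0 = fun t => ov t0 t / (hi t - lo t).
  by apply/funext => t; rewrite /overlap leb1_UI lenUE.
move=> t.
have FF : Filter (nbhs (t : time T)) by exact: nbhs_filter.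
have cv : \val s @[s --> t] --> \val t by exact: continuous_val.
have clo : lo s @[s --> t] --> lo t.
  exact: (cvg_maxr (cvgB cv (cvg_cst eps)) (cvg_cst 0)).
have chi : hi s @[s --> t] --> hi t.
  exact: (cvg_minr (cvgD cv (cvg_cst eps)) (cvg_cst T)).
have ch : Num.min (hi s) (hi t0) @[s --> t] --> Num.min (hi t) (hi t0).
  exact: (cvg_minr chi (cvg_cst (hi t0))).
have cl : Num.max (lo s) (lo t0) @[s --> t] --> Num.max (lo t) (lo t0).
  exact: (cvg_maxr clo (cvg_cst (lo t0))).
have co : ov t0 s @[s --> t] --> ov t0 t.
  apply: cvg_maxr; last exact: cvg_cst.
  exact: cvgB ch cl.
apply: (cvgM co); apply: cvgV; last exact: cvgB chi clo.
by rewrite gt_eqF// subr_gt0.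
Qed.

Lemma overlap01 t0 t : 0 <= overlap t0 t <= 1.
Proof.
rewrite /overlap divr_ge0 ?fine_ge0 ?(ltW (lenU_gt0 _))//=.
rewrite ler_pdivrMr ?lenU_gt0// mul1r /lenU.
have fU s : (leb1 R (U eps s) < +oo)%E by rewrite leb1_U ltry.
have le : (leb1 R (U eps t `&` U eps t0) <= leb1 R (U eps t))%E.
  apply: le_measure; rewrite ?inE//; [|exact: measurable_U].
  by apply: measurableI; exact: measurable_U.
by apply: fine_le => //; rewrite ge0_fin_numE//; exact: (le_lt_trans le (fU t)).
Qed.

Lemma overlapxx t : overlap t t = 1.
Proof. by rewrite /overlap setIid divff// gt_eqF// lenU_gt0. Qed.

(** For fixed [z] the optimizer takes only two values in time, so its average over a window is a
    convex combination of them. *)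
Lemma Av_phistar (gp gm : R * R -> R) delta t0 t z :
  Av eps (phistar gp gm eps t0 delta) t z =
  overlap t0 t * fstar gp gm delta z + (1 - overlap t0 t) * wstar gp gm z.
Proof.
rewrite /Av /phistar/=.
set a := fstar _ _ _ _; set b := wstar _ _ _.
have mU s := measurable_U s.
have Uoo : (leb1 R (U eps t) < +oo)%E by rewrite leb1_U ltry.
transitivity ((lenU eps t)^-1 *
    \int[leb1 R]_(s in U eps t) (b + (a - b) * \1_(U eps t0) s)).
  congr (_ * _); apply: eq_Rintegral => s _; rewrite indicE.
  by case: (s \in U eps t0); rewrite ?mulr1 ?mulr0 ?addr0// addrC subrK.
have i1 : (leb1 R).-integrable (U eps t) (EFin \o \1_(U eps t0)).
  apply: (@ae_bounded_integrable _ _ _ (leb1 R) _ (mU t) 1) => //.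
  by apply: aeW => s _; rewrite indicE; case: (_ \in _); rewrite ?normr1 ?normr0.
have ic (k : R) : (leb1 R).-integrable (U eps t) (EFin \o cst k).
  by apply: (@ae_bounded_integrable _ _ _ (leb1 R) _ (mU t) `|k|) => //; exact: aeW.
rewrite RintegralD//; first last.
- by have := integrableZl (mU t) (a - b) i1; exact.
- exact: ic.
rewrite RintegralZl// Rintegral_cst//.
have -> : \int[leb1 R]_(s in U eps t) \1_(U eps t0) s =
    fine (leb1 R (U eps t `&` U eps t0)).
  by rewrite /Rintegral integral_indic// setIC.
rewrite -/(lenU eps t) /overlap; field.
by rewrite gt_eqF// lenU_gt0.
Qed.

(** [time T] is the image of a compact segment under [f], the retraction of the line onto it, which
    is continuous into the subspace topology. *)
Lemma compact_time : compact [set: time T].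
Proof.
have p (x : R) : Num.max (Num.min x T) 0 \in `[0, T]%classic.
  rewrite inE/= in_itv/= le_max lexx orbT ge_max ge_min lexx orbT/=; exact: ltW.
pose f (x : R) : time T := SigSub (p x).
have cf : continuous f.
  apply: continuous_comp_initial => x /=.
  apply: cvg_maxr; last exact: cvg_cst.
  by apply: cvg_minr; [exact: cvg_id|exact: cvg_cst].
have -> : [set: time T] = f @` `[0, T]%classic.
  apply/seteqP; split => // t _; exists (\val t); first by rewrite /= in_itv/= time_itv.
  apply: val_inj => /=; have /andP[t0 tT] := time_itv t.
  by rewrite (min_idPl tT) (max_idPl t0).
apply: continuous_compact; last exact: segment_compact.
exact: continuous_subspaceT.
Qed.

End window.

(** * Bounded representatives, and averaging as an L1 contraction *)

Section clamp.
Context {R : realType} (T : R).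
Hypothesis T0 : 0 < T.
Implicit Types u v : R * R * R -> R.

Lemma measurable_sqr01T : measurable (sqr01T T).
Proof. by apply: measurableX => //; exact: measurable_itv. Qed.

Lemma leb1_0T : leb1 R `[0, T] = T%:E.
Proof. by rewrite leb1_itvcc ?subr0// ltW. Qed.

Lemma leb3_sqr01T : leb3 R (sqr01T T) = T%:E.
Proof.
transitivity (leb2 R sqr01 * leb1 R `[0%R, T])%E.
  by apply: product_measure1E => //; exact: measurable_itv.
by rewrite leb1_0T leb2_sqr01 mul1e.
Qed.

(** A representative of [u] that is measurable on the whole space and takes values between [0] and
    [1] at every point, so that each of its time sections can be integrated. *)
Definition clamp u : mR R * mR R * mR R -> R :=
  (fun z => Num.max 0 (Num.min 1 (u z))) \_ (sqr01T T).

Lemma clamp01 u z : 0 <= clamp u z <= 1.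
Proof.
rewrite /clamp patchE; case: ifP => _; last by rewrite lexx ler01.
by rewrite le_max lexx ge_max ler01 ge_min lexx.
Qed.

Lemma measurable_clamp u : W0 T u -> measurable_fun setT (clamp u).
Proof.
move=> [mu _]; apply/(measurable_restrictT _ measurable_sqr01T).
by apply: measurable_maxr => //; exact: measurable_minr.
Qed.

Lemma clampE u z : sqr01T T z -> 0 <= u z <= 1 -> clamp u z = u z.
Proof.
move=> Dz /andP[u0 u1]; rewrite /clamp patchE ifT ?inE//.
by rewrite (min_idPr u1) (max_idPr u0).
Qed.

Lemma ae_clampE u : W0 T u ->
  {ae leb3 R, forall z, sqr01T T z -> clamp u z = u z}.
Proof. by move=> [_]; apply: filterS => z /= h Dz; apply: clampE => //; exact: h. Qed.

Lemma clamp_distn u v z : `|clamp u z - clamp v z| <= 1.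
Proof.
have := clamp01 u z; have := clamp01 v z; rewrite ler_norml.
by move=> /andP[? ?] /andP[? ?]; lra.
Qed.

Variable eps : R.
Hypothesis eps0 : 0 < eps.
Implicit Types t : time T.

Let fU t : (leb1 R (U eps t) < +oo)%E.
Proof. by rewrite leb1_U// ltry. Qed.

Let mU t := measurable_U eps t.

(** By Fubini, for almost every [z] the functions [clamp u] and [u] agree at almost every time,
    hence have the same average. *)
Lemma ae_Av_clamp u t : W0 T u -> eq_ae (Av eps (clamp u) t) (Av eps u t).
Proof.
move=> Wu.
have h0 : {ae leb3 R, forall z : R * R * R,
    sqr01T T (z.1, z.2) -> clamp u (z.1, z.2) = u (z.1, z.2)}.
  by apply: filterS (ae_clampE Wu) => -[z s].
pose E z s := sqr01T T (z, s) -> clamp u (z, s) = u (z, s).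
have : {ae leb2 R, forall z, {ae leb1 R, forall s, E z s}}.
  exact: (ae_prod_section (m1 := leb2_sf) (m2 := leb1 R) (P := E) h0).
apply: filterS => z h Qz; rewrite /Av; congr (_ * _).
have mz (v : mR R * mR R * mR R -> R) : measurable_fun setT v ->
    measurable_fun (U eps t : set (mR R)) (fun s : mR R => v (z, s)).
  by move=> mv; apply: measurable_funTS; exact: (measurableT_comp mv).
apply: ae_eq_Rintegral => //.
- by apply: mz; exact: measurable_clamp.
(* [u] is measurable on its domain only, so the section is taken from its extension by zero, with
   which it agrees on the window. *)
- apply: (eq_measurable_fun (fun s => (u \_ (sqr01T T)) (z, s))).
    by move=> s /[!inE] -[_ s0T]; rewrite patchE ifT// inE.
  by apply: mz; apply/(measurable_restrictT _ measurable_sqr01T); exact: Wu.1.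
- by apply: filterS h => s /= h [_ s0T]; apply: h.
Qed.

Lemma sqrU_sub t : sqr01 `*` U eps t `<=` sqr01T T.
Proof. by move=> z [Qz [_ ?]]. Qed.

Let leb2Q_fin : (leb2 R sqr01 < +oo)%E.
Proof. by rewrite [ltLHS]leb2_sqr01 ltry. Qed.

Lemma Rintegral_Av_clamp u t : W0 T u ->
  \int[leb2 R]_(z in sqr01) Av eps (clamp u) t z =
  (lenU eps t)^-1 * \int[leb3 R]_(z in sqr01 `*` U eps t) clamp u z.
Proof.
move=> Wu; have mc := measurable_clamp Wu.
have cM z : `|clamp u z| <= 1.
  by have /andP[? ?] := clamp01 u z; rewrite ger0_norm.
rewrite RintegralZl//.
  congr (_ * _).
  exact: (Rintegral_section (m1 := leb2_sf) (m2 := leb1 R)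
    measurable_sqr01 (mU t) mc cM leb2Q_fin (fU t)).
exact: (integrable_section (m1 := leb2_sf) (m2 := leb1 R)
  measurable_sqr01 (mU t) mc cM leb2Q_fin (fU t)).
Qed.

Lemma integrable_clamp_section u t z : W0 T u ->
  (leb1 R).-integrable (U eps t) (EFin \o (fun s => clamp u (z, s))).
Proof.
move=> Wu; have mc := measurable_clamp Wu.
apply: (@ae_bounded_integrable _ _ _ (leb1 R) _ (mU t) 1).
- exact: fU.
- by apply: measurable_funTS; exact: (measurableT_comp mc).
- by apply: aeW => s _; have /andP[? ?] := clamp01 u (z, s); rewrite ger0_norm.
Qed.

Lemma Av_clamp_S0 u t : W0 T u -> S0 (Av eps (clamp u) t).
Proof.
move=> Wu; have mc := measurable_clamp Wu.
have cM z : `|clamp u z| <= 1.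
  by have /andP[? ?] := clamp01 u z; rewrite ger0_norm.
have l0 := lenU_gt0 T0 eps0 t.
split.
  apply: measurable_funM => //; apply/measurable_EFinP.
  exact: measurable_int (integrable_section (m1 := leb2_sf) (m2 := leb1 R)
    measurable_sqr01 (mU t) mc cM leb2Q_fin (fU t)).
apply: aeW => z Qz; rewrite /Av.
have ci := integrable_clamp_section t z Wu.
apply/andP; split.
  rewrite mulr_ge0 ?invr_ge0 ?(ltW l0)//; apply: Rintegral_ge0 => s _.
  by have /andP[] := clamp01 u (z, s).
rewrite mulrC ler_pdivrMr// mul1r.
rewrite [leRHS](_ : _ = \int[leb1 R]_(s in U eps t) 1).
  apply: le_Rintegral => //; last by move=> s _; have /andP[] := clamp01 u (z, s).
  apply: (@ae_bounded_integrable _ _ _ (leb1 R) _ (mU t) 1); [exact: fU|by []|].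
  by apply: aeW => ? _; rewrite /= normr1.
by rewrite Rintegral_cst// mul1r.
Qed.

Lemma integrable_clampB u v : W0 T u -> W0 T v ->
  (leb3 R).-integrable (sqr01T T) (EFin \o (fun z => clamp u z - clamp v z)).
Proof.
move=> Wu Wv; apply: (@ae_bounded_integrable _ _ _ (leb3 R) _ measurable_sqr01T 1).
- by rewrite [ltLHS]leb3_sqr01T ltry.
- by apply: measurable_funTS; apply: measurable_funB; exact: measurable_clamp.
- by apply: aeW => z _; exact: clamp_distn.
Qed.

(** The absolute value is moved inside the time integral, Fubini turns the result into an integral
    over the slab above the window, and the slab is enlarged to the full domain. *)
Lemma L1_Av_clamp u v t : W0 T u -> W0 T v ->
  \int[leb2 R]_(z in sqr01) `|Av eps (clamp u) t z - Av eps (clamp v) t z| <=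
  (lenU eps t)^-1 * \int[leb3 R]_(z in sqr01T T) `|clamp u z - clamp v z|.
Proof.
move=> Wu Wv; have mc := measurable_clamp Wu; have mc' := measurable_clamp Wv.
have l0 := lenU_gt0 T0 eps0 t.
pose h (z : mR R * mR R * mR R) : R := `|clamp u z - clamp v z|.
have mh : measurable_fun setT h.
  by apply: measurableT_comp => //; exact: measurable_funB.
have hM z : `|h z| <= 1 by rewrite /h normr_id clamp_distn.
have si := integrable_section (m1 := leb2_sf) (m2 := leb1 R)
  measurable_sqr01 (mU t) mh hM leb2Q_fin (fU t).
apply: (@le_trans _ _ (\int[leb2 R]_(z in sqr01)
    ((lenU eps t)^-1 * \int[leb1 R]_(s in U eps t) h (z, s)))).
  apply: le_Rintegral => //.
  - apply: integrable_norm; apply: S0_integrableB; exact: Av_clamp_S0.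
  - by have := integrableZl measurable_sqr01 (lenU eps t)^-1 si; exact.
  - move=> z Qz; rewrite /Av -mulrBr normrM gtr0_norm ?invr_gt0//.
    rewrite ler_pM2l ?invr_gt0// -RintegralB//; try exact: integrable_clamp_section.
    apply: le_normr_Rintegral => //.
    exact: (integrableB (mU t) (integrable_clamp_section t z Wu)
      (integrable_clamp_section t z Wv)).
rewrite RintegralZl; [|exact: measurable_sqr01|exact: si].
rewrite ler_pM2l ?invr_gt0//.
have -> := Rintegral_section (m1 := leb2_sf) (m2 := leb1 R)
  measurable_sqr01 (mU t) mh hM leb2Q_fin (fU t).
apply: subset_le_Rintegral => //.
- exact: measurable_sqr01T.
- exact: measurableX.
- exact: sqrU_sub.
- exact: integrable_norm (integrable_clampB Wu Wv).
- by move=> z _; rewrite /h.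
Qed.

Lemma integrable_clampB_sqr u v : W0 T u -> W0 T v ->
  (leb3 R).-integrable (sqr01T T) (EFin \o (fun z => (clamp u z - clamp v z) ^+ 2)).
Proof.
move=> Wu Wv; apply: (@ae_bounded_integrable _ _ _ (leb3 R) _ measurable_sqr01T 1).
- by rewrite [ltLHS]leb3_sqr01T ltry.
- apply: measurable_funTS; apply: measurable_funX.
  by apply: measurable_funB; exact: measurable_clamp.
- by apply: aeW => z _; rewrite normrX expr_le1 ?clamp_distn.
Qed.

(** Integrates [x <= s / 2 + x^2 / (2 s)], that is [(s - x)^2 >= 0], over a domain of measure [T].
    The free parameter [s] takes the place of the Cauchy-Schwarz inequality. *)
Lemma L1_le_L2 u v s : W0 T u -> W0 T v -> 0 < s ->
  \int[leb3 R]_(z in sqr01T T) `|clamp u z - clamp v z| <=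
  s * T / 2 + (\int[leb3 R]_(z in sqr01T T) (clamp u z - clamp v z) ^+ 2) / (2 * s).
Proof.
move=> Wu Wv s0; have uvi := integrable_clampB Wu Wv.
have mD := measurable_sqr01T.
have Doo : (leb3 R (sqr01T T) < +oo)%E by rewrite [ltLHS]leb3_sqr01T ltry.
have q := integrable_clampB_sqr Wu Wv.
have ci : (leb3 R).-integrable (sqr01T T) (EFin \o cst (s / 2)).
  apply: (@ae_bounded_integrable _ _ _ (leb3 R) _ mD `|s / 2|) => //; exact: aeW.
have qi : (leb3 R).-integrable (sqr01T T)
    (EFin \o (fun z => (clamp u z - clamp v z) ^+ 2 / (2 * s))).
  by have := integrableZr mD (2 * s)^-1 q; exact.
rewrite -RintegralZr// [X in X + _](_ : _ = \int[leb3 R]_(z in sqr01T T) cst (s / 2) z).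
  rewrite -RintegralD//; apply: le_Rintegral => //.
  - exact: integrable_norm.
  - by have := integrableD mD ci qi; exact.
  - move=> z _ /=; rewrite -[X in X / (2 * s)]real_normK ?num_real//.
    set x := `|_|; rewrite -subr_ge0 (_ : _ - _ = (s - x) ^+ 2 / (2 * s)).
      by rewrite divr_ge0 ?sqr_ge0// ltW// mulr_gt0.
    by field; lra.
by rewrite Rintegral_cst// [X in fine X]leb3_sqr01T/=; lra.
Qed.

End clamp.

(** * Minimizers *)

Section energy.
Context {R : realType} (T eps : R) (gp gm : R * R -> R) (c delta : R).
Hypotheses (T0 : 0 < T) (eps0 : 0 < eps) (H : rates gp gm c).
Hypothesis hdelta : 0 < delta < 1 - pstar gp gm.
Implicit Types (u psi : R * R * R -> R) (t : time T).

Local Notation fs := (fstar gp gm delta).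
Local Notation lam := (lambda_delta gp gm delta).
Local Notation P t := (phistar gp gm eps t delta).
Local Notation J := (rate_J T (fun z => gp z.1) (fun z => gm z.1)).
Let mD := measurable_sqr01T T.
Let mU t := measurable_U eps t.

Let m0T : measurable (`[0, T]%classic : set (mR R)).
Proof. exact: measurable_itv. Qed.

Let oT : (leb1 R `[0%R, T] < +oo)%E.
Proof. by rewrite leb1_0T// ltry. Qed.

Let fU t : (leb1 R (U eps t) < +oo)%E.
Proof. by rewrite leb1_U// ltry. Qed.

Lemma S0_fstar : S0 fs.
Proof. exact: S0_f_lambda H _. Qed.

Let fs01 z : sqr01 z -> 0 <= fs z <= 1.
Proof. exact: f_lambda01 H _ _. Qed.

Let measurable_fst_D (f : R * R -> R) :
  measurable_fun (sqr01 : set (mR R * mR R)) (f : mR R * mR R -> R) ->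
  measurable_fun (sqr01T T) (fun z : mR R * mR R * mR R => f z.1).
Proof.
move=> mf; apply: (@measurable_comp _ _ _ _ _ _ sqr01) => //.
  by move=> _ [z [+ _] <-].
exact: measurable_funTS.
Qed.

Lemma W0_phistar t : W0 T (P t).
Proof.
split.
  apply: (eq_measurable_fun (fun z : mR R * mR R * mR R => wstar gp gm z.1 +
      (fs z.1 - wstar gp gm z.1) * \1_(U eps t) z.2)).
    move=> z _; rewrite /phistar indicE.
    by case: (z.2 \in U eps t); rewrite ?mulr1 ?mulr0 ?addr0// addrC subrK.
  have mw := measurable_fst_D (S0_wstar H).1.
  have mf := measurable_fst_D S0_fstar.1.
  apply: measurable_funD => //; apply: measurable_funM; first exact: measurable_funB.
  apply: measurable_funTS.
  exact: (measurableT_comp (measurable_indic (mU t)) measurable_snd).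
have := ae_prod_fst (m1 := leb2_sf) (m2 := leb1 R) (S0_wstar H).2.
apply: filterS => z /= h [Qz _]; rewrite /phistar; case: ifP => _; last exact: h.
exact: fs01.
Qed.

Let measurable_lagr d (X : measurableType d) (D : set X) (p m x : X -> R) :
  measurable_fun D p -> measurable_fun D m -> measurable_fun D x ->
  measurable_fun D (fun z => lagr (p z) (m z) (x z)).
Proof.
move=> mp mm mx; apply: measurable_funX; apply: measurable_funB.
  apply: measurable_fun_sqrt; apply: measurable_funM => //.
  exact: measurable_funB.
by apply: measurable_fun_sqrt; apply: measurable_funM.
Qed.

Let lagr_fs z := lagr (gp z) (gm z) (fs z).

Lemma integrable_lagr u : W0 T u ->
  (leb3 R).-integrable (sqr01T T)
    (EFin \o (fun z => lagr (gp z.1) (gm z.1) (u z))).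
Proof.
move=> [mu u01]; have [mp mm] := measurable_rates H.
have [_ g0 [gpi gmi] _] := H.
have gi := integrable_fst (m1 := leb2_sf) (m2 := leb1 R) measurable_sqr01 m0T oT.
apply: (@ae_le_integrable _ _ _ (leb3 R) _ mD _ (fun z => gp z.1 + gm z.1)).
- by apply: measurable_lagr => //; exact: measurable_fst_D.
- by have := integrableD mD (gi _ gpi) (gi _ gmi); exact.
- apply: filterS u01 => z /= h Dz; have [p0 m0] := g0 _ Dz.1.
  by rewrite ger0_norm ?lagr_ge0// lagr_le//; exact: h.
Qed.

Let integrable_lagr_fs : (leb2 R).-integrable sqr01 (EFin \o lagr_fs).
Proof.
have [mp mm] := measurable_rates H; have [_ g0 [gpi gmi] _] := H.
apply: (@ae_le_integrable _ _ _ (leb2 R) _ measurable_sqr01 _ (fun z => gp z + gm z)).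
- by apply: measurable_lagr => //; exact: S0_fstar.1.
- by have := integrableD measurable_sqr01 gpi gmi; exact.
- apply: aeW => z Qz; have [p0 m0] := g0 _ Qz.
  by rewrite ger0_norm ?lagr_ge0// lagr_le//; exact: fs01.
Qed.

Lemma rate_J_Rintegral u : W0 T u ->
  J u = (\int[leb3 R]_(z in sqr01T T) lagr (gp z.1) (gm z.1) (u z))%:E.
Proof.
move=> Wu; rewrite /Rintegral fineK//.
exact: integrable_fin_num (integrable_lagr Wu).
Qed.

(** The cost per unit of time of staying at [fstar]. *)
Definition energy : R := \int[leb2 R]_(z in sqr01) lagr_fs z.

Let DU t : sqr01T T `&` (sqr01 `*` U eps t) = sqr01 `*` U eps t.
Proof. by apply/setIidPr; exact: sqrU_sub. Qed.

Let Rintegral_sqrU t (g : R * R * R -> R) :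
  \int[leb3 R]_(z in sqr01 `*` U eps t) g z =
  \int[leb3 R]_(z in sqr01T T) (g \_ (sqr01 `*` U eps t)) z.
Proof. by rewrite -[in LHS](DU t) [LHS]Rintegral_mkcondr. Qed.

Let mQU t : measurable (sqr01 `*` U eps t : set (mR R * mR R * mR R)).
Proof. exact: measurableX. Qed.

Let fst_energy t :
  \int[leb3 R]_(z in sqr01 `*` U eps t) lagr_fs z.1 = lenU eps t * energy.
Proof.
rewrite mulrC.
apply: (Rintegral_fst (m1 := leb2_sf) (m2 := leb1 R) measurable_sqr01 (mU t) (fU t)) => //.
by move=> z _; exact: lagr_ge0.
Qed.

Let ae_rates : {ae leb3 R, forall z, sqr01T T z -> c <= gp z.1 /\ c <= gm z.1}.
Proof.
case: H => _ _ _ /(ae_prod_fst (m1 := leb2_sf) (m2 := leb1 R)).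
by apply: filterS => z /= h [Qz _]; exact: h.
Qed.

Let ae_wstar : {ae leb3 R, forall z, sqr01T T z ->
  wstar gp gm z.1 = tilt (gp z.1) (gm z.1) 0}.
Proof.
have /(ae_prod_fst (m1 := leb2_sf) (m2 := leb1 R)) := wstar_f_lambda0 H.
by apply: filterS => z /= h [Qz _]; exact: h.
Qed.

(** Off the window the optimizer equals [wstar], where the integrand vanishes almost everywhere, so
    only the slab above the window contributes. *)
Lemma rate_J_phistar t : J (P t) = (lenU eps t * energy)%:E.
Proof.
rewrite (rate_J_Rintegral (W0_phistar t)) -fst_energy Rintegral_sqrU.
congr EFin; apply: ae_eq_Rintegral => //.
- apply/measurable_EFinP; exact: measurable_int (integrable_lagr (W0_phistar t)).
- apply/(measurable_restrict _ (mQU t) mD); rewrite DU.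
  apply: (@measurable_comp _ _ _ _ _ _ sqr01) => //.
  + by move=> _ [z [+ _] <-].
  + by apply/measurable_EFinP; exact: measurable_int integrable_lagr_fs.
  + exact: measurable_funTS.
have [c0 _ _ _] := H.
apply: filterS2 ae_rates ae_wstar => z h w Dz.
have [cp cm] := h Dz; rewrite /phistar patchE in_setX.
have -> : z.1 \in sqr01 by rewrite inE; case: Dz.
rewrite andTb; case: ifP => _ //; rewrite (w Dz) ?lagr_tilt0//; exact: lt_le_trans c0 _.
Qed.

Local Notation distsq u v :=
  (\int[leb3 R]_(z in sqr01T T) (clamp T u z - clamp T v z) ^+ 2).

(** No density constraint on [psi] is assumed: its violation enters linearly with factor [lam], so
    that paths merely close to admissible ones can be treated. *)
Lemma rate_J_ge psi t : W0 T psi ->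
  ((lenU eps t * energy +
    lam * (\int[leb3 R]_(z in sqr01 `*` U eps t) clamp T psi z
           - lenU eps t * (pstar gp gm + delta)) +
    2 * c * distsq psi (P t))%:E <= J psi)%E.
Proof.
move=> Wpsi; rewrite (rate_J_Rintegral Wpsi) lee_fin.
have [c0 g0 _ _] := H.
(* The affine part of the tangent inequality on the slab. It is extended by zero, since off the slab
   both the slope and the value of [lagr] at [wstar] are zero. *)
pose g (z : R * R * R) := lagr_fs z.1 + lam * (clamp T psi z - fs z.1).
have QUsub : sqr01 `*` U eps t `<=` sqr01T T by exact: sqrU_sub.
have li : (leb3 R).-integrable (sqr01 `*` U eps t) (EFin \o (fun z => lagr_fs z.1)).
  exact: (integrable_fst (m1 := leb2_sf) (m2 := leb1 R)
    measurable_sqr01 (mU t) (fU t) integrable_lagr_fs).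
have fi : (leb3 R).-integrable (sqr01 `*` U eps t) (EFin \o (fun z => fs z.1)).
  exact: (integrable_fst (m1 := leb2_sf) (m2 := leb1 R)
    measurable_sqr01 (mU t) (fU t) (S0_integrable S0_fstar)).
have Doo : (leb3 R (sqr01T T) < +oo)%E by rewrite [ltLHS]leb3_sqr01T// ltry.
have ci : (leb3 R).-integrable (sqr01 `*` U eps t) (EFin \o clamp T psi).
  apply: (integrableS mD (mQU t) QUsub).
  apply: (@ae_bounded_integrable _ _ _ (leb3 R) _ mD 1) => //.
    by apply: measurable_funTS; exact: measurable_clamp.
  by apply: aeW => z _; have /andP[? ?] := clamp01 T psi z; rewrite ger0_norm.
have cfi := integrableB (mQU t) ci fi.
have lcfi := integrableZl (mQU t) lam cfi.
have gi : (leb3 R).-integrable (sqr01 `*` U eps t) (EFin \o g).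
  by have := integrableD (mQU t) li lcfi; exact.
have gE : \int[leb3 R]_(z in sqr01 `*` U eps t) g z = lenU eps t * energy +
    lam * (\int[leb3 R]_(z in sqr01 `*` U eps t) clamp T psi z
           - lenU eps t * (pstar gp gm + delta)).
  rewrite RintegralD// fst_energy RintegralZl//; congr (_ + _ * _).
  rewrite RintegralB//; congr (_ - _).
  have [_ <-] := lambda_deltaP H hdelta; rewrite mulrC.
  apply: (Rintegral_fst (m1 := leb2_sf) (m2 := leb1 R) measurable_sqr01 (mU t) (fU t)).
    exact: S0_integrable S0_fstar.
  by move=> z Qz; have /andP[] := fs01 Qz.
have gDi : (leb3 R).-integrable (sqr01T T) (EFin \o (g \_ (sqr01 `*` U eps t))).
  rewrite -restrict_EFin; apply: (iffLR (integrable_restrict (leb3 R) (mQU t) mD _)).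
  by rewrite [X in integrable _ X](DU t).
have WP := W0_phistar t.
have qi : (leb3 R).-integrable (sqr01T T)
    (EFin \o (fun z => (clamp T psi z - clamp T (P t) z) ^+ 2)).
  exact: integrable_clampB_sqr.
have q2i := integrableZl mD (2 * c) qi.
rewrite -gE Rintegral_sqrU -RintegralZl// -RintegralD//.
apply: ae_le_Rintegral => //.
- by have := integrableD mD gDi q2i; exact.
- exact: integrable_lagr.
near=> z => Dz.
have [cp cm] : c <= gp z.1 /\ c <= gm z.1 by move: Dz; near: z; exact: ae_rates.
have wE : wstar gp gm z.1 = tilt (gp z.1) (gm z.1) 0 by move: Dz; near: z; exact: ae_wstar.
have psiE : clamp T psi z = psi z by move: Dz; near: z; exact: ae_clampE.
have PE : clamp T (P t) z = P t z by move: Dz; near: z; exact: ae_clampE.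
have psi01 : 0 <= psi z <= 1 by rewrite -psiE; exact: clamp01.
have p0 : 0 < gp z.1 by exact: lt_le_trans c0 _.
have m0 : 0 < gm z.1 by exact: lt_le_trans c0 _.
rewrite PE psiE /phistar patchE in_setX.
have -> : z.1 \in sqr01 by rewrite inE; case: Dz.
rewrite andTb; case: ifP => _.
  by rewrite /g psiE; exact: (lagr_tilt_ge _ c0 cp cm psi01).
have := lagr_tilt_ge 0 c0 cp cm psi01.
by rewrite wE lagr_tilt0// mul0r addr0.
Unshelve. all: by end_near.
Qed.

(** The tangent inequality of slope [0] bounds [2 c x^2] by the integrand, where [x = fstar - wstar]
    has mean [delta]. Integrating [x <= delta / 2 + x^2 / (2 delta)] then gives
    [delta / 2 <= energy / (4 c delta)]. *)
Lemma energy_gt0 : 0 < energy.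
Proof.
have [c0 _ _ hc] := H; have /andP[d0 _] := hdelta.
have Sf := S0_fstar; have Sw := S0_wstar H.
have [_ fsE] := lambda_deltaP H hdelta.
have fwi := S0_integrableB Sf Sw.
have k0 : 0 < 4 * c * delta by rewrite !mulr_gt0.
have ei : (leb2 R).-integrable sqr01 (EFin \o (fun z => lagr_fs z / (4 * c * delta))).
  by have := integrableZr measurable_sqr01 (4 * c * delta)^-1 integrable_lagr_fs; exact.
have : delta <= delta / 2 + energy / (4 * c * delta).
  rewrite [leLHS](_ : _ = \int[leb2 R]_(z in sqr01) (fs z - wstar gp gm z)).
    rewrite -[X in X + _]Rintegral_cst_sqr01 /energy -RintegralZr//.
    rewrite -RintegralD//; last exact: integrable_cst_sqr01.
    apply: ae_le_Rintegral => //.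
      by have := integrableD measurable_sqr01 (integrable_cst_sqr01 (delta / 2)) ei; exact.
    apply: filterS2 hc (wstar_f_lambda0 H) => z h w Qz /=.
    have [cp cm] := h Qz.
    have p0 := lt_le_trans c0 cp; have m0 := lt_le_trans c0 cm.
    have wE : wstar gp gm z = tilt (gp z) (gm z) 0 := w Qz.
    have := lagr_tilt_ge 0 c0 cp cm (fs01 Qz).
    rewrite lagr_tilt0// mul0r addr0 add0r -/(lagr_fs z) -wE.
    set x := _ - _; set L := lagr_fs z => hL.
    rewrite -subr_ge0 (_ : _ - _ = ((delta - x) ^+ 2 +
      (L - 2 * c * x ^+ 2) / (2 * c)) / (2 * delta)); last by field; lra.
    rewrite divr_ge0 ?addr_ge0 ?sqr_ge0 ?divr_ge0 ?subr_ge0//; lra.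
  rewrite RintegralB//; [|exact: S0_integrable|exact: S0_integrable].
  by rewrite [X in X - _]fsE -/(pstar gp gm) addrAC subrr add0r.
rewrite -lerBlDl; have -> : delta - delta / 2 = delta / 2 by field.
move=> /(lt_le_trans (divr_gt0 d0 (ltr0Sn R 1))).
by rewrite pmulr_lgt0// invr_gt0.
Qed.

End energy.

(** * Paths of classes and their edge densities *)

Section paths.
Context {R : realType} (T : R).
Hypothesis T0 : 0 < T.
Implicit Types (f g : R * R -> R) (t : time T)
  (p : time T -> set (R * R -> R)) (phi : time T -> R * R -> R).

Lemma dmp_le1 f g : S0 f -> S0 g -> dmp f g <= 1.
Proof.
move=> Sf Sg; apply: le_trans (dmp_le_dcut Sf Sg) _.
apply: le_trans (dcut_le_L1 Sf Sg) _; rewrite -[leRHS]Rintegral_cst_sqr01.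
apply: ae_le_Rintegral => //.
- exact: integrable_norm (S0_integrableB Sf Sg).
- exact: integrable_cst_sqr01.
apply: filterS2 Sf.2 Sg.2 => z hf hg Qz.
have /andP[? ?] := hf Qz; have /andP[? ?] := hg Qz.
by rewrite ler_norml /=; lra.
Qed.

Lemma path_hatS0_hat p t : path_hatS0 p -> exists2 f, S0 f & p t = hat f.
Proof. by case=> + _ => /(_ t)[f Sf <-]; exists f. Qed.

(** The distances are bounded by [1], so the real supremum over time does dominate each of them. *)
Lemma deltacut_lt_sup p phi eta t : path_hatS0 p -> pathS0 phi ->
  sup (range (fun t => deltacut (p t) (hat_path phi t))) < eta ->
  deltacut (p t) (hat (phi t)) < eta.
Proof.
move=> hp [Sphi _]; apply: le_lt_trans; apply: ub_le_sup; last by exists t.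
exists 1 => _ [s _ <-]; have [f Sf ->] := path_hatS0_hat s hp.
by rewrite deltacut_hat//; exact: dmp_le1.
Qed.

Lemma edge_density_deltacut p s t : path_hatS0 p ->
  `|edge_density (p t) - edge_density (p s)| <= deltacut (p t) (p s).
Proof.
move=> hp; have [f Sf ->] := path_hatS0_hat t hp.
have [g Sg ->] := path_hatS0_hat s hp.
by rewrite deltacut_hat// !edge_density_hat//; exact: Rintegral_dmp.
Qed.

Lemma edge_density_le1 p t : path_hatS0 p -> edge_density (p t) <= 1.
Proof.
move=> hp; have [f Sf ->] := path_hatS0_hat t hp.
by rewrite edge_density_hat//; have /andP[] := S0_Rintegral01 Sf.
Qed.

Lemma continuous_edge_density p : path_hatS0 p ->
  continuous (fun t => edge_density (p t)).
Proof.
move=> hp t; have FF : Filter (nbhs (t : time T)) by exact: nbhs_filter.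
apply/cvgrPdist_lt => e e0.
have /cvgrPdist_lt /(_ e e0) := hp.2 t; apply: filterS => s.
rewrite sub0r normrN; apply: le_lt_trans.
exact: le_trans (edge_density_deltacut s t hp) (ler_norm _).
Qed.

(** Turns the constraint on a supremum into a constraint at a single time, the form in which
    [rate_J_lower] uses it. *)
Lemma edge_density_sup_attained p (TT : set (time T)) r :
  path_hatS0 p -> TT !=set0 -> closed TT ->
  r <= sup [set edge_density (p t) | t in TT] ->
  exists2 t, TT t & r <= edge_density (p t).
Proof.
move=> hp TT0 cTT rsup.
have cpt : compact TT := subclosed_compact cTT (compact_time T0) (@subsetT _ TT).
have [|t tTT tmax] := compact_EVT_max TT0 cpt (f := fun t => edge_density (p t)).
  exact/continuous_subspaceT/continuous_edge_density.
exists t; first by rewrite -inE.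
apply: le_trans rsup _; apply: ge_sup.
  by case: TT0 => s sTT; exists (edge_density (p s)); exists s.
by move=> _ [s sTT <-]; apply: tmax; rewrite inE.
Qed.

End paths.

(** * Value of the infimum and uniqueness of the minimizing path *)

Section minimizers.
Context {R : realType} (T eps : R) (gp gm : R * R -> R) (c delta : R).
Hypotheses (T0 : 0 < T) (eps0 : 0 < eps) (H : rates gp gm c).
Hypothesis hdelta : 0 < delta < 1 - pstar gp gm.
Implicit Types (psi : R * R * R -> R) (s t : time T)
  (p : time T -> set (R * R -> R)) (phi : time T -> R * R -> R).

Local Notation fs := (fstar gp gm delta).
Local Notation lam := (lambda_delta gp gm delta).
Local Notation P t := (phistar gp gm eps t delta).
Local Notation J := (rate_J T (fun z => gp z.1) (fun z => gm z.1)).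
Local Notation hatI :=
  (rate_hatI (T := T) (fun z => gp z.1) (fun z => gm z.1) eps).
Local Notation K := (energy gp gm delta).
Local Notation best t := (Av eps (P t) : time T -> R * R -> R).

Let bestE t s : best t s =
  fun z => overlap eps t s * fs z + (1 - overlap eps t s) * wstar gp gm z.
Proof. by apply/funext => z; exact: Av_phistar. Qed.

Let S0_best t s : S0 (best t s).
Proof.
have [mf f01] := S0_fstar delta H; have [mw w01] := S0_wstar H; rewrite bestE; split.
  by apply: measurable_funD; apply: measurable_funM.
have /andP[q0 q1] := overlap01 T0 eps0 t s.
apply: filterS2 f01 w01 => z hf hw Qz.
have /andP[? ?] := hf Qz; have /andP[? ?] := hw Qz.
by apply/andP; split; nra.
Qed.

(** Dominates the product by [1 + g^2], using that [f] lies between [0] and [1] almost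
    everywhere. *)
Let integrable_S0_L2 f g : S0 f -> L2 g ->
  (leb2 R).-integrable sqr01 (EFin \o (fun z => f z * g z)).
Proof.
move=> [mf f01] [mg gi].
have gi' := integrableD measurable_sqr01 (integrable_cst_sqr01 1) gi.
apply: (@ae_le_integrable _ _ _ (leb2 R) _ measurable_sqr01 _ (fun z => 1 + g z ^+ 2)).
- exact: measurable_funM.
- exact: gi'.
apply: filterS f01 => z h Qz; have /andP[f0 f1] := h Qz.
rewrite normrM (ger0_norm f0) -[g z ^+ 2]real_normK ?num_real//.
have := normr_ge0 (g z); move: (`|g z|) => x x0; nra.
Qed.

(** Pairing with [g] gives an affine function of [overlap], so weak continuity reduces to continuity
    of [overlap]. *)
Lemma pathS0_best t : pathS0 (best t).
Proof.
split=> [s|g Lg s]; first exact: S0_best.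
set a := \int[leb2 R]_(z in sqr01) (fs z * g z).
set b := \int[leb2 R]_(z in sqr01) (wstar gp gm z * g z).
have fgi := integrable_S0_L2 (S0_fstar delta H) Lg.
have wgi := integrable_S0_L2 (S0_wstar H) Lg.
have -> : (fun r => \int[leb2 R]_(z in sqr01) (best t r z * g z)) =
    fun r => overlap eps t r * a + (1 - overlap eps t r) * b.
  apply/funext => r; rewrite /a /b -!RintegralZl// -RintegralD//.
  - by apply: eq_Rintegral => z _; rewrite bestE; ring.
  - by have := integrableZl measurable_sqr01 (overlap eps t r) fgi; exact.
  - by have := integrableZl measurable_sqr01 (1 - overlap eps t r) wgi; exact.
have co : overlap eps t r @[r --> s] --> overlap eps t s.
  exact: continuous_overlap.
have FF : Filter (nbhs (s : time T)) by exact: nbhs_filter.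
have c1 : 1 - overlap eps t r @[r --> s] --> 1 - overlap eps t s.
  exact: cvgB (cvg_cst (1 : R)) co.
exact: cvgD (cvgM co (cvg_cst a)) (cvgM c1 (cvg_cst b)).
Qed.

(** The values at two times differ by the difference of overlaps times [fs - wstar], and the latter
    is at most [1] in absolute value. *)
Lemma path_hatS0_best t : path_hatS0 (hat_path (best t)).
Proof.
split=> [s|s]; first by exists (best t s).
have FF : Filter (nbhs (s : time T)) by exact: nbhs_filter.
apply/cvgrPdist_lt => e e0.
have co : overlap eps t r @[r --> s] --> overlap eps t s.
  exact: continuous_overlap.
have /cvgrPdist_lt /(_ e e0) := co; apply: filterS => r.
have Ss := S0_best t s; have Sr := S0_best t r.
move=> sr; rewrite /hat_path deltacut_hat// sub0r normrN ger0_norm ?dmp_ge0//.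
apply: le_lt_trans sr.
apply: le_trans (dmp_le_dcut Ss Sr) _; apply: le_trans (dcut_le_L1 Ss Sr) _.
rewrite -[leRHS]Rintegral_cst_sqr01; apply: ae_le_Rintegral => //.
- exact: integrable_norm (S0_integrableB Ss Sr).
- exact: integrable_cst_sqr01.
apply: filterS2 (S0_fstar delta H).2 (S0_wstar H).2 => z hf hw Qz.
have /andP[? ?] := hf Qz; have /andP[? ?] := hw Qz.
rewrite !bestE [X in `|X|](_ : _ =
  (overlap eps t s - overlap eps t r) * (fs z - wstar gp gm z)); last by ring.
rewrite normrM -[leRHS]mulr1 ler_wpM2l// ler_norml.
by apply/andP; split; lra.
Qed.

Lemma edge_density_best t : edge_density (hat_path (best t) t) = pstar gp gm + delta.
Proof.
rewrite /hat_path edge_density_hat// bestE overlapxx//.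
have [_ <-] := lambda_deltaP H hdelta; apply: eq_Rintegral => z _.
by rewrite subrr mul0r addr0 mul1r.
Qed.

(** For every [eta] the path itself is a competitor at distance zero, and [P t] is one of the
    functions it averages. *)
Lemma rate_hatI_best t : (hatI (hat_path (best t)) <= (lenU eps t * K)%:E)%E.
Proof.
apply: ge_ereal_sup => _ [eta /= eta0 <-].
apply: (@le_trans _ _ (rate_I (fun z => gp z.1) (fun z => gm z.1) eps (best t))).
  apply: ereal_inf_lbound; exists (best t) => //; split; first exact: pathS0_best.
  apply: le_lt_trans eta0; apply: ge_sup.
    by exists (deltacut (hat_path (best t) t) (hat_path (best t) t)); exists t.
  by move=> _ [s _ <-]; rewrite /hat_path deltacut_hat// dmpxx.
rewrite -(rate_J_phistar delta T0 eps0 H).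
apply: ereal_inf_lbound; exists (P t) => //; split; first exact: (W0_phistar _ _ H).
by move=> s; exact: aeW.
Qed.

(** The edge density is 1-Lipschitz for the distance of classes, so that of [phi t] is above
    [pstar + delta - eta]. It is also the mean of [psi] over the slab, and [rate_J_ge] applies with
    a loss of at most [lam * lenU eps t * eta]. *)
Lemma rate_J_lower p phi psi eta t : path_hatS0 p -> pathS0 phi ->
  pstar gp gm + delta <= edge_density (p t) ->
  deltacut (p t) (hat (phi t)) < eta -> W0 T psi ->
  eq_ae (Av eps psi t) (phi t) ->
  ((lenU eps t * K - lam * lenU eps t * eta + 2 * c *
     \int[leb3 R]_(z in sqr01T T) (clamp T psi z - clamp T (P t) z) ^+ 2)%:E
   <= J psi)%E.
Proof.
move=> hp [Sphi _] hpt ppeta Wpsi eqphi.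
apply: le_trans (rate_J_ge T0 eps0 H hdelta t Wpsi); rewrite lee_fin lerD2r lerD2l.
have [l0 _] := lambda_deltaP H hdelta.
have u0 := lenU_gt0 T0 eps0 t.
have [f Sf pE] := path_hatS0_hat t hp.
have := Rintegral_dmp Sf (Sphi t).
rewrite pE deltacut_hat// in ppeta; rewrite pE edge_density_hat// in hpt.
rewrite (@ae_eq_Rintegral _ _ _ (leb2 R) _ measurable_sqr01 (phi t)
  (Av eps (clamp T psi) t)); last 3 first.
- exact: (Sphi t).1.
- exact: (Av_clamp_S0 T0 eps0 t Wpsi).1.
- apply: filterS2 eqphi (ae_Av_clamp eps t Wpsi) => z h1 h2 Qz.
  by rewrite h2// h1.
rewrite Rintegral_Av_clamp//.
set X := \int[leb3 R]_(z in sqr01 `*` U eps t) clamp T psi z.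
move: hpt ppeta; set F := \int[leb2 R]_(z in sqr01) f z; move: (dmp _ _) => D.
move=> hpt Deta /(le_trans (ler_norm _)) FX.
have Xge : pstar gp gm + delta - eta <= (lenU eps t)^-1 * X by lra.
have {}Xge : lenU eps t * (pstar gp gm + delta - eta) <= X.
  by rewrite mulrC -ler_pdivlMr// mulrC.
rewrite -mulrA -mulrN ler_wpM2l//; lra.
Qed.

Lemma rate_hatI_ge p t : path_hatS0 p ->
  pstar gp gm + delta <= edge_density (p t) -> ((lenU eps t * K)%:E <= hatI p)%E.
Proof.
move=> hp hpt; apply/lee_addgt0Pr => e e0.
have [l0 _] := lambda_deltaP H hdelta; have [c0 _ _ _] := H.
have u0 := lenU_gt0 T0 eps0 t.
have k0 : 0 < lam * lenU eps t + 1 by rewrite ltr_wpDl// mulr_ge0// ltW.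
(* Makes the loss [lam * lenU eps t * eta] at most [e]. The [+ 1] keeps the divisor positive when
   [lam] is zero. *)
pose eta : R := e / (lam * lenU eps t + 1).
have eta0 : 0 < eta by rewrite divr_gt0.
rewrite -leeBlDr// -EFinB.
apply: (@le_trans _ _ (ereal_inf
    [set rate_I (fun z => gp z.1) (fun z => gm z.1) eps phi | phi in
      [set phi | pathS0 phi /\
        sup (range (fun t => deltacut (p t) (hat_path phi t))) < eta]])); last first.
  by apply: ereal_sup_ubound; exists eta.
apply: le_ereal_inf_tmp => _ [phi [pphi supphi] <-].
apply: le_ereal_inf_tmp => _ [psi [Wpsi Avpsi] <-].
have := rate_J_lower hp pphi hpt (deltacut_lt_sup t hp pphi supphi) Wpsi (Avpsi t).
apply: le_trans; rewrite lee_fin.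
set X := Rintegral _ _ _.
have X0 : 0 <= X by apply: Rintegral_ge0 => z _; exact: sqr_ge0.
have : lam * lenU eps t * eta <= e.
  have -> : e = (lam * lenU eps t + 1) * eta by rewrite mulrC divfK// gt_eqF.
  by rewrite ler_pM2r// lerDl.
have : 0 <= 2 * c * X by rewrite !mulr_ge0// ltW.
lra.
Qed.

(** For each [e], some [phi] near [p] is the average of an almost optimal [psi]. The lower bound
    forces [psi] to be close to [P t] in L2, hence [phi s] to be close to [best t s] at every time
    [s]. *)
Lemma rate_hatI_unique p t : path_hatS0 p ->
  pstar gp gm + delta <= edge_density (p t) -> (hatI p <= (lenU eps t * K)%:E)%E ->
  p = hat_path (best t).
Proof.
move=> hp hpt Ip; apply/funext => s.
have [f Sf pE] := path_hatS0_hat s hp.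
have Sg := S0_best t s.
rewrite pE; apply: hat_eq => //; apply/le_anti/andP; split; last exact: dmp_ge0.
apply/ler_addgt0Pr => e e0; rewrite add0r.
have [l0 _] := lambda_deltaP H hdelta; have [c0 _ _ _] := H.
have u0 := lenU_gt0 T0 eps0 t; have us0 := lenU_gt0 T0 eps0 s.
(* With this [r], the first term [r * T / 2] of [L1_le_L2], divided by [lenU eps s], is exactly
   [e / 2]. *)
pose r : R := e * lenU eps s / T.
have r0 : 0 < r by rewrite divr_gt0// mulr_gt0.
(* An excess cost below [eta] leaves [2 c X < eta (1 + lam * lenU eps t)] for the squared distance
   [X], that is [X <= eta * B]. *)
pose B : R := (1 + lam * lenU eps t) / (2 * c).
have B0 : 0 < B by rewrite divr_gt0 ?mulr_gt0// ltr_pwDl// mulr_ge0// ltW.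
(* Collects the two errors linear in [eta]: the distance from [p s] to [phi s], and the contribution
   of [X]. With [eta * k = e / 2] the total is [e]. *)
pose k : R := 1 + (lenU eps s)^-1 * (B / (2 * r)).
have k0 : 0 < k by rewrite addr_gt0// mulr_gt0 ?invr_gt0// divr_gt0// mulr_gt0.
pose eta : R := e / 2 / k.
have eta0 : 0 < eta by rewrite !divr_gt0.
have : (ereal_inf
    [set rate_I (fun z => gp z.1) (fun z => gm z.1) eps phi | phi in
      [set phi | pathS0 phi /\
        (sup (range (fun t => deltacut (p t) (hat_path phi t))) < eta)%R]]
    < (lenU eps t * K + eta)%:E)%E.
  apply: (@le_lt_trans _ _ (lenU eps t * K)%:E); last by rewrite lte_fin ltrDl.
  by apply: le_trans Ip; apply: ereal_sup_ubound; exists eta.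
move=> /ereal_inf_lt[_ [phi [pphi supphi] <-]] /ereal_inf_lt[_ [psi [Wpsi Avpsi] <-]] Jpsi.
have near_p q := deltacut_lt_sup q hp pphi supphi.
have := rate_J_lower hp pphi hpt (near_p t) Wpsi (Avpsi t).
move=> /le_lt_trans/(_ Jpsi); rewrite lte_fin.
have WP : W0 T (P t) by exact: (W0_phistar _ _ H).
have L12 := L1_le_L2 T0 Wpsi WP r0.
set X := \int[leb3 R]_(z in sqr01T T) (_ ^+ 2) in L12 * => hX.
have {}hX : X <= eta * B.
  by rewrite /B mulrA ler_pdivlMr ?mulr_gt0//; nra.
have Sphi := pphi.1 s.
apply: le_trans (dmp_triangle Sf Sphi Sg) _.
have fphi : dmp f (phi s) < eta by have := near_p s; rewrite pE deltacut_hat.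
have phig : dmp (phi s) (best t s) <= (lenU eps s)^-1 * (r * T / 2 + X / (2 * r)).
  apply: le_trans (dmp_le_dcut Sphi Sg) _; apply: le_trans (dcut_le_L1 Sphi Sg) _.
  have := L1_Av_clamp T0 eps0 s Wpsi WP.
  move=> /le_trans/(_ (ler_wpM2l _ L12)); rewrite invr_ge0 => /(_ (ltW us0)).
  apply: le_trans.
  have Spsi := Av_clamp_S0 T0 eps0 s Wpsi; have SP := Av_clamp_S0 T0 eps0 s WP.
  apply: ae_le_Rintegral => //; try exact: integrable_norm (S0_integrableB _ _).
  have h2 := ae_Av_clamp eps s Wpsi; have h3 := ae_Av_clamp eps s WP.
  apply: filterS3 (Avpsi s) h2 h3 => z e1 e2 e3 Qz.
  by rewrite e2// e3// e1.
have {}phig : dmp (phi s) (best t s) <= e / 2 + (lenU eps s)^-1 * (eta * B / (2 * r)).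
  apply: le_trans phig _; rewrite mulrDr; apply: lerD.
    by rewrite /r le_eqVlt; apply/orP; left; apply/eqP; field; rewrite !gt_eqF.
  rewrite ler_pM2l ?invr_gt0// ler_pM2r// invr_gt0 mulr_gt0//.
have ekE : eta + (lenU eps s)^-1 * (eta * B / (2 * r)) = e / 2.
  transitivity (eta * k); first by rewrite /k; ring.
  by rewrite /eta divfK// gt_eqF.
by apply: le_trans (lerD (ltW fphi) phig) _; rewrite addrCA ekE -splitr.
Qed.

End minimizers.

Unset Implicit Arguments.

Theorem proposition3p25 (R : realType) (T : R) (hT : 0 < T)
    (gammap gammam : R * R -> R)
    (gammap_ge0 : forall z, sqr01 z -> 0 <= gammap z)
    (gammam_ge0 : forall z, sqr01 z -> 0 <= gammam z)
    (gammap_L1 : (leb2 R).-integrable sqr01 (fun z => (gammap z)%:E))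
    (gammam_L1 : (leb2 R).-integrable sqr01 (fun z => (gammam z)%:E))
    (cbeta : R) (cbeta_gt0 : 0 < cbeta)
    (gammap_ge : {ae leb2 R, forall z, sqr01 z -> cbeta <= gammap z})
    (gammam_ge : {ae leb2 R, forall z, sqr01 z -> cbeta <= gammam z})
    (delta : R) (hdelta : 0 < delta < 1 - pstar gammap gammam)
    (eps : R) (heps : 0 < eps < T)
    (TT : set (time T)) (TT0 : TT !=set0) (TTclosed : closed TT) :
  hatH gammap gammam eps delta TT =
  [set hat_path (Av eps (phistar gammap gammam eps t delta)) | t in
    argmin (lenU eps) TT].
Proof.
have /andP[eps0 _] := heps.
have H : rates gammap gammam cbeta.
  split => // [z Qz|]; first by split; [exact: gammap_ge0|exact: gammam_ge0].
  by apply: filterS2 gammap_ge gammam_ge => z hp hm Qz; split; [exact: hp|exact: hm].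
have feasible t : TT t -> let p := hat_path (Av eps (phistar gammap gammam eps t delta)) in
    path_hatS0 p /\ pstar gammap gammam + delta <= sup [set edge_density (p t) | t in TT].
  move=> TTt p; have hp : path_hatS0 p := path_hatS0_best delta hT eps0 H t.
  split => //; rewrite -(edge_density_best hT eps0 H hdelta t).
  apply: ub_le_sup; last by exists t.
  by exists 1 => _ [s _ <-]; exact: edge_density_le1.
have K0 := energy_gt0 H hdelta.
apply/seteqP; split => [p [[hp psup] pmin]|_ [t [TTt tmin] <-]].
  have [t TTt pt] := edge_density_sup_attained hT hp TT0 TTclosed psup.
  (* Each time in [TT] provides an admissible competitor, which bounds the value of the minimizer
     [p]. *)
  have Ip s : TT s -> (rate_hatI (fun z => gammap z.1) (fun z => gammam z.1) eps p
      <= (lenU eps s * energy gammap gammam delta)%:E)%E.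
    move=> TTs; apply: le_trans (pmin _ (feasible s TTs)) _.
    exact: (rate_hatI_best delta hT eps0 H s).
  exists t; last exact/esym/(rate_hatI_unique hT eps0 H hdelta hp pt (Ip t TTt)).
  (* Positivity of the energy turns the comparison of costs into a comparison of window lengths. *)
  split => // s TTs; rewrite -(ler_pM2r K0) -lee_fin.
  exact: le_trans (rate_hatI_ge hT eps0 H hdelta hp pt) (Ip s TTs).
split; first exact: feasible.
move=> p [hp psup].
(* A competitor meets the constraint at some time [s] of [TT], whose window is at least as long as
   the one around [t]. *)
have [s TTs ps] := edge_density_sup_attained hT hp TT0 TTclosed psup.
apply: le_trans (rate_hatI_best delta hT eps0 H t) _.
apply: le_trans (rate_hatI_ge hT eps0 H hdelta hp ps).
by rewrite lee_fin ler_pM2r//; exact: tmin.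
Qed.
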